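(* Let $\mathcal{A}$ be a C*-algebra and let $E,F$ be Hilbert $\mathcal{A}$-modules. On the space $B(E,F)$ of all bounded adjointable operators from $E$ to $F$, the metric $(T,S)\mapsto\|T-S\|$ given by the usual operator norm and the gap metric $d$ are equivalent, i.e. they induce the same topology on $B(E,F)$.
   Context: $\mathcal{A}$ is an arbitrary (not necessarily unital) C*-algebra. Hilbert $\mathcal{A}$-modules are left modules with $\mathcal{A}$-valued inner product that is $\mathcal{A}$-linear in the first variable. $B(E,F)$ is the set of $\mathcal{A}$-linear maps $T:E\to F$ for which there is $T^*:F\to E$ with $\langle Tx,y\rangle=\langle x,T^*y\rangle$ for all $x\in E$, $y\in F$. For $T\in B(E,F)$ the graph $G(T)=\{(x,Tx):x\in E\}$ is an orthogonally complemented submodule of $E\oplus F$; $P_{G(T)}\in B(E\oplus F)$ denotes the orthogonal projection onto it. The gap metric is $d(T,S)=\|P_{G(T)}-P_{G(S)}\|$. *)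

(* Defs.v *)
From HB Require Import structures.
From mathcomp Require Import all_boot all_order all_algebra.
From mathcomp Require Import complex.
From mathcomp Require Import all_classical all_reals all_analysis.

Set Implicit Arguments.
Unset Strict Implicit.
Unset Printing Implicit Defensive.

Import Order.TTheory GRing.Theory Num.Theory.
Import numFieldNormedType.Exports.

Local Open Scope classical_set_scope.
Local Open Scope ring_scope.
Local Open Scope complex_scope.

(* The multiplication is a bare operation because the ring structures of the
   library all have a unit, which a C*-algebra need not have. *)
HB.mixin Record CompleteNormedModule_isCStarAlgebra (R : realType) A
    of CompleteNormedModule R[i] A := {
  cmul : A -> A -> A;
  cstar : A -> A;
  cmulA : associative cmul;
  cmulDl : left_distributive cmul +%R;
  cmulDr : right_distributive cmul +%R;
  cmulZl : forall (k : R[i]) (a b : A), cmul (k *: a) b = k *: cmul a b;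
  cmulZr : forall (k : R[i]) (a b : A), cmul a (k *: b) = k *: cmul a b;
  cnormM : forall a b : A, `|cmul a b| <= `|a| * `|b|;
  cstarK : involutive cstar;
  cstarD : {morph cstar : a b / a + b};
  cstarZ : forall (k : R[i]) (a : A), cstar (k *: a) = k^* *: cstar a;
  cstarM : forall a b : A, cstar (cmul a b) = cmul (cstar b) (cstar a);
  cnorm_star : forall a : A, `|cmul (cstar a) a| = `|a| ^+ 2
}.

#[short(type="cstarAlgType")]
HB.structure Definition CStarAlgebra (R : realType) :=
  {A of CompleteNormedModule R[i] A & CompleteNormedModule_isCStarAlgebra R A}.

Definition cpositive (R : realType) (A : cstarAlgType R) (a : A) : Prop :=
  exists b : A, a = cmul (cstar b) b.

(* Left A-modules with an A-valued hermitian form. Positivity, definiteness and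
   completeness are added in HilbertModule below; they are kept apart so that
   the direct sum of two modules is available without first showing that a sum
   of positive elements is positive. *)
HB.mixin Record Lmodule_isHermitianModule (R : realType) (A : cstarAlgType R) E
    of GRing.Lmodule R[i] E := {
  act : A -> E -> E;
  inner : E -> E -> A;
  actDl : forall (a b : A) (x : E), act (a + b) x = act a x + act b x;
  actDr : forall (a : A) (x y : E), act a (x + y) = act a x + act a y;
  actM : forall (a b : A) (x : E), act (cmul a b) x = act a (act b x);
  actZl : forall (k : R[i]) (a : A) (x : E), act (k *: a) x = k *: act a x;
  actZr : forall (k : R[i]) (a : A) (x : E), act a (k *: x) = k *: act a x;
  innerDl : forall x y z : E, inner (x + y) z = inner x z + inner y z;
  innerZl : forall (k : R[i]) (x y : E), inner (k *: x) y = k *: inner x y;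
  inner_act : forall (a : A) (x y : E), inner (act a x) y = cmul a (inner x y);
  inner_star : forall x y : E, cstar (inner x y) = inner y x
}.

#[short(type="hermitianModType")]
HB.structure Definition HermitianModule (R : realType) (A : cstarAlgType R) :=
  {E of GRing.Lmodule R[i] E & Lmodule_isHermitianModule R A E}.

(* The norm of A takes its values in R[i]; they are real, so the real part
   loses nothing. *)
Definition hnorm (R : realType) (A : cstarAlgType R) (E : hermitianModType A)
    (x : E) : R :=
  Num.sqrt (complex.Re `|inner x x : A|).

HB.mixin Record HermitianModule_isHilbertModule (R : realType)
    (A : cstarAlgType R) E of HermitianModule R A E := {
  inner_pos : forall x : E, cpositive (inner x x : A);
  inner_eq0 : forall x : E, inner x x = 0 :> A -> x = 0;
  hnorm_complete : forall u : nat -> E,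
    (forall e : R, 0 < e -> exists N : nat, forall m n : nat,
       (N <= m)%N -> (N <= n)%N -> hnorm (u m - u n) < e) ->
    exists l : E, forall e : R, 0 < e -> exists N : nat, forall n : nat,
       (N <= n)%N -> hnorm (u n - l) < e
}.

#[short(type="hilbertModType")]
HB.structure Definition HilbertModule (R : realType) (A : cstarAlgType R) :=
  {E of HermitianModule R A E & HermitianModule_isHilbertModule R A E}.

Section DirectSum.
Variables (R : realType) (A : cstarAlgType R) (E F : hermitianModType A).

Let dact (a : A) (z : E * F) : E * F := (act a z.1, act a z.2).
Let dinner (z w : E * F) : A := inner z.1 w.1 + inner z.2 w.2.

Let dactDl (a b : A) (z : E * F) : dact (a + b) z = dact a z + dact b z.
Proof. by rewrite /dact !actDl. Qed.

Let dactDr (a : A) (z w : E * F) : dact a (z + w) = dact a z + dact a w.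
Proof. by rewrite /dact !actDr. Qed.

Let dactM (a b : A) (z : E * F) : dact (cmul a b) z = dact a (dact b z).
Proof. by rewrite /dact !actM. Qed.

Let dactZl (k : R[i]) (a : A) (z : E * F) : dact (k *: a) z = k *: dact a z.
Proof. by rewrite /dact !actZl. Qed.

Let dactZr (k : R[i]) (a : A) (z : E * F) : dact a (k *: z) = k *: dact a z.
Proof. by rewrite /dact !actZr. Qed.

Let dinnerDl (x y z : E * F) : dinner (x + y) z = dinner x z + dinner y z.
Proof. by rewrite /dinner !innerDl addrACA. Qed.

Let dinnerZl (k : R[i]) (x y : E * F) : dinner (k *: x) y = k *: dinner x y.
Proof. by rewrite /dinner !innerZl scalerDr. Qed.

Let dinner_act (a : A) (x y : E * F) :
  dinner (dact a x) y = cmul a (dinner x y).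
Proof. by rewrite /dinner !inner_act cmulDr. Qed.

Let dinner_star (x y : E * F) : cstar (dinner x y) = dinner y x.
Proof. by rewrite /dinner cstarD !inner_star. Qed.

HB.instance Definition _ := Lmodule_isHermitianModule.Build R A (E * F)%type
  dactDl dactDr dactM dactZl dactZr dinnerDl dinnerZl dinner_act dinner_star.

End DirectSum.

Section Adjointable.
Variables (R : realType) (A : cstarAlgType R).

(* Adjointable maps between Hilbert modules are automatically bounded, hence the
   supremum defining opnorm is finite for them. *)
Record adjointable (E F : hermitianModType A) := Adjointable {
  adj_fun :> E -> F;
  adj_linear : linear adj_fun;
  adj_act : forall (a : A) (x : E), adj_fun (act a x) = act a (adj_fun x);
  adj_ex : exists T' : F -> E,
    forall (x : E) (y : F), inner (adj_fun x) y = inner x (T' y) :> A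
}.

HB.instance Definition _ (E F : hermitianModType A) :=
  gen_eqMixin (adjointable E F).
HB.instance Definition _ (E F : hermitianModType A) :=
  gen_choiceMixin (adjointable E F).

Lemma adjointable_id_ex (E : hermitianModType A) : exists T' : E -> E,
  forall x y : E, inner (idfun x) y = inner x (T' y) :> A.
Proof. by exists idfun. Qed.

Definition adjointable_id (E : hermitianModType A) : adjointable E E :=
  @Adjointable E E idfun (fun _ _ _ => erefl) (fun _ _ => erefl)
    (adjointable_id_ex E).

Definition opnorm (E F : hermitianModType A) (T : E -> F) : R :=
  sup [set hnorm (T x) | x in [set x : E | hnorm x <= 1]].

Definition graph (E F : hermitianModType A) (T : E -> F) : set (E * F)%type :=
  [set (x, T x) | x in [set: E]].

Definition orthogonal_projection (E : hermitianModType A) (M : set E)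
    (P : adjointable E E) : Prop :=
  [/\ forall x : E, P (P x) = P x,
      forall x y : E, inner (P x) y = inner x (P y) :> A
    & range P = M].

(* adjointable_id is a dummy value for submodules which are not orthogonally
   complemented. *)
Definition projection_onto (E : hermitianModType A) (M : set E) :
    adjointable E E :=
  xget (adjointable_id E) (orthogonal_projection M).

Definition norm_dist (E F : hermitianModType A) (T S : adjointable E F) : R :=
  opnorm (T \- S).

Definition gap_dist (E F : hermitianModType A) (T S : adjointable E F) : R :=
  opnorm (projection_onto (graph T) \- projection_onto (graph S)).

End Adjointable.

Definition metric_topology (R : realType) (X : Type) (d : X -> X -> R) :
    set (set X) :=
  [set U | forall x, U x -> exists2 e : R, 0 < e & [set y | d x y < e] `<=` U].

(* Main.v *)
Require Import Defs.
From HB Require Import structures.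
From mathcomp Require Import all_boot all_order all_algebra.
From mathcomp Require Import complex ring lra.
From mathcomp Require Import all_classical all_reals all_analysis.

(* In the unitization of A, an element is called positive when it is self-adjoint
   and lies in the closed ball of radius t around some t >= 0. This makes the
   positive elements a cone, and the square root (by the power-series iteration)
   gives the two facts that carry everything: b* b is positive, and
   |a| <= |a + b| for a, b positive. They yield the Cauchy-Schwarz inequality in
   Hilbert modules; the contraction x |-> x - s ((1 + T* T) x - y) with small s
   then shows that 1 + T* T is onto, so the projection P_T on the graph of T
   exists.

   Since (1 - P_S) P_T z = (1 - P_S) (0, (T - S) u) when P_T z = (u, T u), one gets
   |P_T - P_S| <= |(1 - P_S) P_T| + |(1 - P_T) P_S| <= 2 |T - S|. Conversely, if
   g = |P_T - P_S|, comparing (x, S x) = P_S (x, S x) with P_T (x, S x) gives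
   |(T - S) x| <= (1 + |T|) g |(x, S x)|, and the term |(T - S) x| hidden in
   |(x, S x)| can be absorbed on the left once g is small. *)

Set Implicit Arguments.
Unset Strict Implicit.
Unset Printing Implicit Defensive.

Import Order.TTheory GRing.Theory Num.Theory.
Import numFieldNormedType.Exports.

Local Open Scope classical_set_scope.
Local Open Scope ring_scope.
Local Open Scope complex_scope.

(** * Real-valued norms and convergence over the complex numbers *)

Section RealNorm.
Variable R : realType.

(** The real part of the [R[i]]-valued norm, so that estimates are carried out in the ordered field
    [R]. *)
Definition rnorm (V : normedZmodType R[i]) (x : V) : R := complex.Re `|x|.

Lemma rnormE (V : normedZmodType R[i]) (x : V) : `|x| = (rnorm x)%:C.
Proof. by rewrite /rnorm RRe_real// normr_real. Qed.

Lemma rnorm_ge0 (V : normedZmodType R[i]) (x : V) : 0 <= rnorm x.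
Proof. by rewrite -ler0c -rnormE normr_ge0. Qed.

Lemma rnormD (V : normedZmodType R[i]) (x y : V) :
  rnorm (x + y) <= rnorm x + rnorm y.
Proof. by rewrite -lecR rmorphD /= -!rnormE ler_normD. Qed.

Lemma rnormN (V : normedZmodType R[i]) (x : V) : rnorm (- x) = rnorm x.
Proof. by rewrite /rnorm normrN. Qed.

Lemma rnorm_eq0 (V : normedZmodType R[i]) (x : V) : rnorm x = 0 -> x = 0.
Proof. by move=> x0; apply/eqP; rewrite -normr_eq0 rnormE x0. Qed.

Lemma rnorm0 (V : normedZmodType R[i]) : rnorm (0 : V) = 0.
Proof. by rewrite /rnorm normr0. Qed.

Lemma rnormZ (V : normedModType R[i]) (k : R[i]) (x : V) :
  rnorm (k *: x) = rnorm k * rnorm x.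
Proof. by apply: complexI; rewrite rmorphM /= -!rnormE normrZ. Qed.

Lemma rnormM (x y : R[i]) : rnorm (x * y) = rnorm x * rnorm y.
Proof. by apply: complexI; rewrite rmorphM /= -!rnormE normrM. Qed.

Lemma rnorm_real (t : R) : rnorm t%:C = `|t|.
Proof. by rewrite /rnorm normc_def /= expr0n addr0 sqrtr_sqr. Qed.

Lemma rnorm_pos (t : R) : 0 <= t -> rnorm t%:C = t.
Proof. by move=> t0; rewrite rnorm_real ger0_norm. Qed.

Lemma rnorm_i : rnorm ('i%C : R[i]) = 1.
Proof. by rewrite /rnorm normc_def /= expr0n add0r expr1n sqrtr1. Qed.

Lemma conjE (k : R[i]) : (k^*)%R = conjc k.
Proof. by []. Qed.

Lemma rnorm_conj (k : R[i]) : rnorm (k^*)%R = rnorm k.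
Proof. by rewrite conjE /rnorm normcJ. Qed.

Lemma rnorm_conjM (k : R[i]) : rnorm ((k^*)%R * k) = rnorm k ^+ 2.
Proof. by rewrite rnormM rnorm_conj. Qed.

(** The size function [N] is a parameter, so that one pair of notions serves [rnorm], [unorm] and
    [hnorm]. *)
Definition cauchy_for (V : zmodType) (N : V -> R) (u : nat -> V) :=
  forall e : R, 0 < e -> exists n0 : nat, forall m n : nat,
    (n0 <= m)%N -> (n0 <= n)%N -> N (u m - u n) < e.

Definition cvg_for (V : zmodType) (N : V -> R) (u : nat -> V) (l : V) :=
  forall e : R, 0 < e -> exists n0 : nat, forall n : nat,
    (n0 <= n)%N -> N (u n - l) < e.

Lemma completeNormedModule_cvg (A : completeNormedModType R[i]) (u : nat -> A) :
  cauchy_for (@rnorm A) u -> exists l, cvg_for (@rnorm A) u l.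
Proof.
move=> cu; have : cvg (u @ \oo).
  apply: cauchy_cvg; apply: cauchy_exP => e e0.
  have re : e = (complex.Re e)%:C by rewrite RRe_real// gtr0_real.
  have /cu[n0 Hn0] : 0 < complex.Re e by rewrite -ltcR -re.
  exists (u n0); exists n0 => // n /= n0n.
  by rewrite -ball_normE /= rnormE re ltcR; apply: Hn0.
move/cvg_ex=> [l ul]; exists l => e e0.
have : \forall n \near \oo, `|l - u n| < e%:C.
  by move/cvgrPdist_lt: ul; apply; rewrite ltcR.
move=> [n0 _ Hn0]; exists n0 => n n0n.
by rewrite -rnormN opprB -ltcR -rnormE; apply: Hn0.
Qed.

Lemma real_cvg (u : nat -> R) :
  cauchy_for Num.norm u -> exists l, cvg_for Num.norm u l.
Proof.
move=> cu; have : cvg (u @ \oo).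
  apply: cauchy_cvg; apply: cauchy_exP => e /cu[n0 Hn0].
  exists (u n0); exists n0 => // n /= n0n.
  by rewrite -ball_normE /=; apply: Hn0.
move/cvg_ex=> [l ul]; exists l => e e0.
have [n0 _ Hn0] : \forall n \near \oo, `|l - u n| < e.
  by move/cvgrPdist_lt: ul; apply.
by exists n0 => n n0n; rewrite distrC; apply: Hn0.
Qed.

Lemma norm_Re (k : R[i]) : `|complex.Re k| <= rnorm k.
Proof. by rewrite -lecR -rnormE normc_ge_Re. Qed.

Lemma norm_Im (k : R[i]) : `|complex.Im k| <= rnorm k.
Proof.
have := norm_Re (k * 'i%C).
by rewrite rnormM rnorm_i mulr1 ReiNIm normrN.
Qed.

Lemma complex_cvg (u : nat -> R[i]) :
  cauchy_for (@rnorm R[i]) u -> exists l, cvg_for (@rnorm R[i]) u l.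
Proof.
move=> cu.
have [a ua] : exists l, cvg_for Num.norm (fun n => complex.Re (u n)) l.
  apply: real_cvg => e /cu[n0 Hn0]; exists n0 => m n hm hn.
  by rewrite -raddfB; apply: le_lt_trans (norm_Re _) (Hn0 _ _ hm hn).
have [b ub] : exists l, cvg_for Num.norm (fun n => complex.Im (u n)) l.
  apply: real_cvg => e /cu[n0 Hn0]; exists n0 => m n hm hn.
  by rewrite -raddfB; apply: le_lt_trans (norm_Im _) (Hn0 _ _ hm hn).
exists (a +i* b) => e e0; have e20 : 0 < e / 2 by rewrite divr_gt0.
have [n1 H1] := ua _ e20; have [n2 H2] := ub _ e20.
exists (maxn n1 n2) => n; rewrite geq_max => /andP[h1 h2].
rewrite [u n - _]complexE.
apply: le_lt_trans (rnormD _ _) _.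
rewrite rnormM rnorm_i mul1r !rnorm_real [ltRHS]splitr.
by rewrite !raddfB/=; apply: ltrD; [apply: H1|apply: H2].
Qed.

End RealNorm.

(** * Positive elements of a unital C*-algebra *)

(** A predicate on plain functions, to be met by the unitization. The norm laws are inequalities,
    the form in which an operator norm provides them; the equalities [NZp] and [Nstar] are
    derived. *)
Record unital_cstar (R : realType) (B : algType R[i]) (star : B -> B)
    (N : B -> R) : Prop := {
  ucs_starK : involutive star;
  ucs_starD : {morph star : a b / a + b};
  ucs_starZ : forall (k : R[i]) a, star (k *: a) = (k^*)%R *: star a;
  ucs_starM : forall a b, star (a * b) = star b * star a;
  ucs_norm_ge0 : forall a, 0 <= N a;
  ucs_normD : forall a b, N (a + b) <= N a + N b;
  ucs_normZ : forall (k : R[i]) a, N (k *: a) <= rnorm k * N a;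
  ucs_normM : forall a b, N (a * b) <= N a * N b;
  ucs_norm1 : N 1 <= 1;
  ucs_norm_cstar : forall a, N a ^+ 2 <= N (star a * a);
  ucs_norm_eq0 : forall a, N a = 0 -> a = 0;
  ucs_norm_cvg : forall u, cauchy_for N u -> exists l, cvg_for N u l
}.

Section UnitalCStar.
Variables (R : realType) (B : algType R[i]) (star : B -> B) (N : B -> R).
Hypothesis hB : unital_cstar star N.
Implicit Types (a b c h k u v x y : B) (r s t : R).

Let starK := ucs_starK hB.
Let starD := ucs_starD hB.
Let starZ := ucs_starZ hB.
Let starM := ucs_starM hB.
Let N_ge0 := ucs_norm_ge0 hB.
Let ND := ucs_normD hB.
Let NM := ucs_normM hB.

Let star0 : star 0 = 0.
Proof. by apply: (addrI (star 0)); rewrite -starD !addr0. Qed.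

Let starN a : star (- a) = - star a.
Proof. by apply: (addrI (star a)); rewrite -starD !subrr star0. Qed.

Let starB a b : star (a - b) = star a - star b.
Proof. by rewrite starD starN. Qed.

Let star1 : star 1 = 1.
Proof. by rewrite -[LHS]mulr1 -{2}[1]starK -starM mulr1 starK. Qed.

Let starZr t a : star (t%:C *: a) = t%:C *: star a.
Proof. by rewrite starZ conjE conjc_real. Qed.

Let NZr t a : N (t%:C *: a) <= `|t| * N a.
Proof. by have := ucs_normZ hB t%:C a; rewrite rnorm_real. Qed.

Let NN a : N (- a) = N a.
Proof.
have le b : N (- b) <= N b.
  rewrite -scaleN1r -(rmorphN1 (real_complex R)).
  by apply: le_trans (NZr _ _) _; rewrite normrN normr1 mul1r.
by apply/eqP; rewrite eq_le le -{1}[a]opprK le.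
Qed.

Let N0 : N 0 = 0.
Proof.
apply/eqP; rewrite eq_le N_ge0 -(scale0r 0) (le_trans (NZr 0 _))//.
by rewrite normr0 mul0r.
Qed.

Let NB a b : N (a - b) <= N a + N b.
Proof. by rewrite -(NN b) ND. Qed.

Let NZp t a : 0 <= t -> N (t%:C *: a) = t * N a.
Proof.
move=> t0; have /= h := NZr t a; rewrite ger0_norm// in h.
apply/eqP; rewrite eq_le h/=.
have [->|tn0] := eqVneq t 0; first by rewrite mul0r N_ge0.
have := NZr t^-1 (t%:C *: a).
rewrite scalerA -rmorphM/= mulVf// scale1r ger0_norm ?invr_ge0// => h2.
by rewrite -ler_pdivlMl// lt_def tn0.
Qed.

Let Nstar a : N (star a) = N a.
Proof.
have le b : N b <= N (star b).
  have [->|b0] := eqVneq (N b) 0; first exact: N_ge0.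
  have bp : 0 < N b by rewrite lt_def b0 N_ge0.
  rewrite -(ler_pM2r bp) -expr2.
  by apply: le_trans (ucs_norm_cstar hB b) (NM _ _).
by apply/eqP; rewrite eq_le le andbT -{2}[a]starK le.
Qed.

Let N1r t : 0 <= t -> N (t%:C *: 1) <= t.
Proof. by move=> t0; rewrite NZp// ler_piMr// (ucs_norm1 hB). Qed.

(** The form in which identities pass to limits: [a] is the difference of the two sides. *)
Let N_small a (C : R) : (forall e : R, 0 < e -> N a <= C * e) -> a = 0.
Proof.
move=> H; apply: (ucs_norm_eq0 hB); apply/eqP; rewrite eq_le N_ge0 andbT.
have C0 : 0 <= C by have := H 1 ltr01; rewrite mulr1; apply: le_trans.
apply/ler_addgt0Pr => e e0; rewrite add0r.
have := H (e / (C + 1)); rewrite divr_gt0 ?ltr_wpDl// => /(_ isT) /le_trans; apply.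
rewrite mulrCA ler_piMr ?(ltW e0)//.
by rewrite ler_pdivrMr ?mul1r ?lerDl ?ltr_wpDl.
Qed.

(* The positive solution of [y = (u + y^2) / 2] is [1 - sqrt (1 - u)]; iterating
   from [0], the increments are dominated by those of the scalar iteration for
   [u = 1], which increases to [1]. *)
Let step u y := (2^-1)%:C *: (u + y * y).
Let sc n : R := iter n (fun s => 2^-1 * (1 + s ^+ 2)) 0.

(** With [d = 1 - sc n] the iteration becomes [d - d ^+ 2 / 2], so [d] decays like [2 / n]. This
    rate makes the iterates in the algebra a Cauchy sequence. *)
Let sc_bound n : [/\ 0 <= sc n, sc n <= 1 & (1 - sc n) * n.+1%:R <= 2].
Proof.
elim: n => [|n [h0 h1 h2]]; first by rewrite /sc /= subr0 mulr1; split=> //; lra.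
rewrite /sc iterS -/(sc n).
split; [by nra| by nra|].
(* The start is treated apart because the bound [2 / q <= 1] below relies on [q >= 2]. *)
case: n h0 h1 h2 => [|m] h0 h1 h2; first by rewrite /sc/=; nra.
set s := sc m.+1 in h0 h1 h2 *.
have n1 : (2 : R) <= m.+2%:R by rewrite ler_nat.
rewrite -[m.+3]addn1 natrD; set q : R := m.+2%:R in h2 n1 *.
set d := 1 - s in h2 *.
have dE : s = 1 - d by rewrite /d; ring.
rewrite dE in h0 h1 *.
have q0 : 0 < q by lra.
have -> : (1 - 2^-1 * (1 + (1 - d) ^+ 2)) * (q + 1) = (d - d ^+ 2 / 2) * (q+1).
  by field.
have d2q : d <= 2 / q by rewrite ler_pdivlMr.
have q1 : 2 / q <= 1 by rewrite ler_pdivrMr// mul1r.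
(* The map [d - d ^+ 2 / 2] increases on [[0, 1]], so [d] may be replaced by its upper bound
   [2 / q]. *)
have : d - d ^+ 2 / 2 <= 2 / q - (2 / q) ^+ 2 / 2.
  set w := 2 / q in d2q q1 *.
  have : 0 <= (w - d) * (1 - (w + d) / 2) by apply: mulr_ge0; lra.
  lra.
move=> hh; apply: (@le_trans _ _ ((2 / q - (2 / q) ^+ 2 / 2) * (q + 1))).
  by apply: ler_wpM2r hh; lra.
have -> : (2 / q - (2 / q) ^+ 2 / 2) * (q + 1) = 2 - 2 / q ^+ 2.
  by field; rewrite gt_eqF.
by rewrite gerBl divr_ge0// exprn_ge0// ltW.
Qed.

(** Take [k = 1 - l] for the limit [l] of the iteration: [l = (u + l * l) / 2] amounts to
    [(1 - l) ^+ 2 = 1 - u]. Each iterate is self-adjoint and commutes with whatever commutes with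
    [u]; both properties survive in the limit. *)
Lemma unital_sqrt u : N u <= 1 -> star u = u -> exists k,
  [/\ k * k = 1 - u, star k = k, N (1 - k) <= 1
    & forall c, c * u = u * c -> c * k = k * c].
Proof.
move=> u1 su.
pose y n := iter n (step u) 0.
have yS n : y n.+1 = step u (y n) by [].
have h2 : 0 <= 2^-1 :> R by rewrite invr_ge0.
have yb n : N (y n) <= sc n /\ N (y n.+1 - y n) <= sc n.+1 - sc n.
  elim: n => [|n [IH1 IH2]].
    split; first by rewrite /y /= N0.
    rewrite yS /y/= subr0 /step mul0r addr0 NZp// /sc/= expr0n/= addr0 subr0.
    by rewrite ler_wpM2l.
  have IH3 : N (y n.+1) <= sc n.+1.
    rewrite yS NZp// /sc iterS -/(sc n) ler_wpM2l//.
    apply: le_trans (ND _ _) _; apply: lerD => //.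
    by apply: le_trans (NM _ _) _; rewrite expr2 ler_pM.
  split=> //.
  (* This splitting of a difference of squares holds without commutation, and the scalar increments
     obey the same identity. *)
  have -> : y n.+2 - y n.+1 =
      (2^-1)%:C *: (y n.+1 * (y n.+1 - y n) + (y n.+1 - y n) * y n).
    rewrite yS [in X in _ - X = _]yS /step -scalerBr; congr (_ *: _).
    rewrite mulrBr mulrBl addrA subrK opprD addrACA subrr add0r.
    by [].
  rewrite NZp//.
  have -> : sc n.+2 - sc n.+1 =
      2^-1 * (sc n.+1 * (sc n.+1 - sc n) + (sc n.+1 - sc n) * sc n).
    rewrite {1}/sc iterS -/(sc n.+1) [in X in _ - X = _]/sc iterS -/(sc n).
    by ring.
  rewrite ler_wpM2l//; apply: le_trans (ND _ _) _.
  by apply: lerD; apply: le_trans (NM _ _) _; apply: ler_pM.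
have yd n d : N (y (n + d)%N - y n) <= sc (n + d)%N - sc n.
  elim: d => [|d IH]; first by rewrite addn0 !subrr N0.
  rewrite addnS -(subrKA (y (n + d)%N)) -[leRHS](subrKA (sc (n + d)%N)).
  by apply: le_trans (ND _ _) _; apply: lerD => //; have [] := yb (n + d)%N.
have yc n m : (n <= m)%N -> N (y m - y n) <= 2 / n.+1%:R.
  move=> /subnKC <-; apply: le_trans (yd _ _) _.
  have [_ _ a1] := sc_bound n; have [_ a2 _] := sc_bound (n + (m - n))%N.
  apply: (@le_trans _ _ (1 - sc n)); first by rewrite lerD2r.
  by rewrite ler_pdivlMr.
have arch (e : R) : 0 < e -> exists n : nat, 2 / n.+1%:R < e.
  move=> e0; exists (Num.trunc (2 / e)); rewrite ltr_pdivrMr//.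
  by rewrite mulrC -ltr_pdivrMr// truncnS_gt.
have [l yl] : exists l, cvg_for N y l.
  apply: (ucs_norm_cvg hB) => e /arch[n0 hn0]; exists n0 => m n hm hn.
  wlog nm : m n hm hn / (n <= m)%N.
    move=> H; have [|/ltnW mn] := leqP n m; first exact: H.
    by rewrite -NN opprB; apply: H.
  apply: le_lt_trans (yc _ _ nm) _; apply: le_lt_trans hn0.
  by rewrite ler_pM2l// lef_pV2 ?posrE// ler_nat ltnS.
have y1 n : N (y n) <= 1.
  by have [/le_trans h _] := yb n; have [_ s1 _] := sc_bound n; apply: h.
have l1 : N l <= 1.
  apply/ler_addgt0Pr => e /yl[n /(_ n (leqnn _)) hn].
  rewrite -[l](subKr (y n)); apply: le_trans (NB _ _) _.
  by rewrite lerD// ltW.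
have lE : l = step u l.
  apply/eqP; rewrite -subr_eq0; apply/eqP; apply: (@N_small _ 2) => e /yl[n hn].
  have -> : l - step u l = - (y n.+1 - l) +
     (2^-1)%:C *: (y n * (y n - l) + (y n - l) * l).
    have -> : y n * (y n - l) + (y n - l) * l = (u + y n * y n) - (u + l * l).
      by rewrite mulrBr mulrBl addrA subrK opprD addrACA subrr add0r.
    by rewrite yS scalerBr -/(step _ _) -/(step _ _) opprB addrA subrK.
  apply: le_trans (ND _ _) _; rewrite NN mulr_natl mulr2n; apply: lerD.
    by apply/ltW/hn/leqnSn.
  rewrite NZp// ler_pdivrMl//; apply: le_trans (ND _ _) _.
  have := hn n (leqnn _) => hnn.
  rewrite [leRHS]mulrDl mul1r; apply: lerD; apply: le_trans (NM _ _) _.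
    by rewrite -[leRHS]mul1r; apply: ler_pM => //; apply: ltW.
  by rewrite -[leRHS]mulr1; apply: ler_pM => //; apply: ltW.
have sy n : star (y n) = y n.
  by elim: n => [|n IH]; rewrite ?star0// yS /step starZr starD starM IH su.
have sl : star l = l.
  apply/eqP; rewrite -subr_eq0; apply/eqP; apply: (@N_small _ 2) => e.
  move=> /yl[n /(_ n (leqnn _)) hn].
  rewrite -[_ - l](subrKA (y n)) -{1}(sy n) -starB.
  by apply: le_trans (ND _ _) _; rewrite Nstar mulr_natl mulr2n -NN opprB lerD ?ltW.
exists (1 - l); split.
- have : (2%:R)%:C *: l = u + l * l.
    by rewrite {1}lE /step scalerA -rmorphM/= divff// scale1r.
  rewrite rmorphD scalerDl !scale1r => e2.
  rewrite mulrBl mul1r mulrBr mulr1 -[in RHS](addrK (l * l) u) -e2.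
  by rewrite !opprB addrACA [RHS]addrA opprD.
- by rewrite starB star1 sl.
- by rewrite subKr.
- move=> c cu.
  have cy n : c * y n = y n * c.
    elim: n => [|n IH]; first by rewrite mulr0 mul0r.
    rewrite yS /step -scalerAr -scalerAl mulrDr mulrDl cu.
    by rewrite mulrA IH -mulrA IH mulrA.
  rewrite mulrBr mulrBl mulr1 mul1r; congr (_ - _).
  apply/eqP; rewrite -subr_eq0; apply/eqP; apply: (@N_small _ (2 * N c)) => e.
  move=> /yl[n /(_ n (leqnn _)) hn].
  have -> : c * l - l * c = (y n - l) * c - c * (y n - l).
    by rewrite mulrBl mulrBr cy opprB [RHS]addrC subrKA.
  apply: le_trans (NB _ _) _; rewrite -mulrA mulr_natl mulr2n lerD//.
    by apply: le_trans (NM _ _) _; rewrite mulrC ler_wpM2l// ltW.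
  by apply: le_trans (NM _ _) _; rewrite ler_wpM2l// ltW.
Qed.

(** * The cone of positive elements *)

Let ii : 'i%C * 'i%C = -1 :> R[i].
Proof. by rewrite -expr2 sqr_i. Qed.

Let conj_i : conjc 'i%C = - 'i%C :> R[i].
Proof. by apply/eqP; rewrite eq_complex/= oppr0 !eqxx. Qed.

Let conj_mul_commute a b : a * b = b * a ->
  (a - 'i%C *: b) * (a + 'i%C *: b) = a * a + b * b.
Proof.
move=> ab; rewrite mulrDr !mulrBl -!scalerAl -!scalerAr scalerA ii scaleN1r.
by rewrite opprK ab addrA subrK.
Qed.

(** For self-adjoint [a] the ball condition says that the spectrum lies in [[0, 2 t]]. *)
Definition upos a := star a = a /\ exists2 t : R, 0 <= t & N (t%:C%:A - a) <= t.

Lemma upos_shift t a : star a = a -> N a <= t -> upos (t%:C%:A - a).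
Proof.
move=> sa at_; split; first by rewrite starB starZr star1 sa.
by exists t; rewrite ?subKr// (le_trans (N_ge0 a)).
Qed.

(** Centres and radii of the two balls add up. *)
Lemma uposD a b : upos a -> upos b -> upos (a + b).
Proof.
move=> [sa [s s0 hs]] [sb [t t0 ht]]; split; first by rewrite starD sa sb.
exists (s + t); first exact: addr_ge0.
rewrite rmorphD scalerDl opprD addrACA; apply: le_trans (ND _ _) _.
exact: lerD.
Qed.

Lemma uposZ t a : 0 <= t -> upos a -> upos (t%:C *: a).
Proof.
move=> t0 [sa [s s0 hs]]; split; first by rewrite starZr sa.
exists (t * s); first exact: mulr_ge0.
by rewrite rmorphM -scalerA -scalerBr NZp// ler_wpM2l.
Qed.

(** After division by the radius [t], the element is within distance 1 of the unit, so [unital_sqrt]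
    applies; its root is then multiplied by the square root of [t]. *)
Lemma upos_sqrt a : upos a -> exists k,
  [/\ k * k = a, star k = k, upos k & forall c, c * a = a * c -> c * k = k * c].
Proof.
move=> [sa [t0 t00 ht0]].
(* The radius is enlarged to make it invertible. *)
pose t := t0 + 1; have tp : 0 < t by rewrite ltr_wpDl.
have ht : N (t%:C%:A - a) <= t.
  rewrite rmorphD scalerDl addrAC; apply: le_trans (ND _ _) _.
  by rewrite lerD// N1r.
have tV : t^-1%:C * t%:C = 1 :> R[i] by rewrite -rmorphM/= mulVf// gt_eqF.
have [||k [kk sk k1 ck]] := @unital_sqrt (1 - t^-1%:C *: a).
- have -> : 1 - t^-1%:C *: a = t^-1%:C *: (t%:C%:A - a).
    by rewrite scalerBr scalerA tV scale1r.
  by rewrite NZp ?invr_ge0 ?(ltW tp)// ler_pdivrMl// mulr1.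
- by rewrite starB star1 starZr sa.
pose s := Num.sqrt t; have s0 : 0 <= s by exact: sqrtr_ge0.
have ss : s%:C * s%:C = t%:C :> R[i] by rewrite -rmorphM/= -expr2 sqr_sqrtr// ltW.
exists (s%:C *: k); split.
- rewrite -scalerAl -scalerAr scalerA ss kk subKr scalerA mulrC tV.
  by rewrite scale1r.
- by rewrite starZr sk.
- split; first by rewrite starZr sk.
  by exists s => //; rewrite -scalerBr NZp// ler_piMr.
- move=> c ca; rewrite -scalerAr -scalerAl ck//.
  by rewrite mulrBr mulrBl mulr1 mul1r -scalerAr -scalerAl ca.
Qed.

(* [V = (t - k^2) + i k (2 t - k^2)^(1/2)] satisfies [V* V = t^2], and [t - k^2]
   is its real part. *)
Lemma norm_sub_sq t k : star k = k -> N k ^+ 2 <= 2 * t -> N (t%:C%:A - k * k) <= t.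
Proof.
move=> sk kt; have t0 : 0 <= t.
  by have := le_trans (exprn_ge0 2 (N_ge0 k)) kt; rewrite pmulr_rge0.
have skk : star (k * k) = k * k by rewrite starM sk.
have [|w [ww sw _ cw]] := @upos_sqrt ((2 * t)%:C%:A - k * k).
  apply: upos_shift => //.
  by apply: le_trans (NM _ _) _; rewrite -expr2.
have kw : k * w = w * k.
  by apply: cw; rewrite mulrBr mulrBl mulrA mulr_algl mulr_algr.
pose p := t%:C%:A - k * k; pose q := k * w; rewrite -/p.
have sp : star p = p by rewrite starB starZr star1 skk.
have sq : star q = q by rewrite /q starM sk sw kw.
have kq : k * q = q * k by rewrite /q -[RHS]mulrA -kw.
have pq : p * q = q * p.
  have kkq : k * k * q = q * (k * k) by rewrite -mulrA kq mulrA kq -mulrA.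
  by rewrite mulrBl mulrBr mulr_algl mulr_algr kkq.
have qq : q * q = (2 * t)%:C *: (k * k) - k * k * (k * k).
  rewrite /q {2}kw -[LHS]mulrA (mulrA w w) ww [LHS]mulrA.
  rewrite mulrBr mulrBl mulr_algr -scalerAl.
  by rewrite !mulrA.
have ppqq : p * p + q * q = (t * t)%:C%:A.
  pose d := t%:C *: (k * k) + t%:C *: (k * k) - k * k * (k * k).
  rewrite qq mulr_natl mulr2n rmorphD scalerDl -[RHS](subrK d).
  congr (_ + _); rewrite /p mulrBr mulr_algr scalerBr mulrBl mulr_algl.
  by rewrite scalerA -rmorphM/= -addrA -opprD addrA.
pose V := p + 'i%C *: q.
have sV : star V = p - 'i%C *: q.
  by rewrite starD sp starZ sq conjE conj_i scaleNr.
have VV : star V * V = (t * t)%:C%:A.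
  by rewrite sV /V conj_mul_commute.
have Vt : N V <= t.
  rewrite -ler_sqr ?nnegrE//; apply: le_trans (ucs_norm_cstar hB _) _.
  by rewrite VV -expr2 N1r// exprn_ge0.
have e2 : (2%:R)%:C *: p = V + star V.
  by rewrite sV /V addrACA subrr addr0 rmorphD scalerDl scale1r.
have : N ((2%:R)%:C *: p) <= t + t.
  by rewrite e2; apply: le_trans (ND _ _) _; rewrite Nstar lerD.
by rewrite NZp// mulr_natl mulr2n; lra.
Qed.

Lemma upos_sq k : star k = k -> upos (k * k).
Proof.
move=> sk; split; first by rewrite starM sk.
exists (2^-1 * N k ^+ 2); first by rewrite mulr_ge0 ?invr_ge0 ?exprn_ge0.
by apply: norm_sub_sq => //; lra.
Qed.

(** Positivity supplies some radius; writing [a] as a square shows that every [t >= N a / 2] is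
    one. *)
Lemma norm_sub_upos t a : upos a -> N a <= 2 * t -> N (t%:C%:A - a) <= t.
Proof.
move=> /upos_sqrt[k [<- sk _ _]] kt; apply: norm_sub_sq => //.
by have := ucs_norm_cstar hB k; rewrite sk => /le_trans; apply.
Qed.

(** For [r] just above [N (a + b)], the element [q = r - a] is positive, being [(r - (a + b)) + b].
    If [N q <= 2 r], then [N a = N (r - q) <= r]. If [N q > 2 r], then [N a <= 2 r] would force
    [N q <= r], while [N a > 2 r] would make each of [N a], [N q] smaller than the other by at least
    [r]. *)
Lemma upos_norm_le a b : upos a -> upos b -> N a <= N (a + b).
Proof.
move=> pa pb; apply/ler_addgt0Pr => e e0; set r := N (a + b) + e.
have r0 : 0 < r by rewrite ltr_wpDl.
have rab : N (a + b) <= r by rewrite lerDl ltW.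
pose q := r%:C%:A - a.
have pq : upos q.
  have -> : q = r%:C%:A - (a + b) + b by rewrite opprD addrA subrK.
  apply: uposD => //; apply: upos_shift => //.
  by have [sa _] := pa; have [sb _] := pb; rewrite starD sa sb.
have aE : a = r%:C%:A - q by rewrite subKr.
(* The ball of radius [N c / 2] is available; moving its centre to [r] costs [N c / 2 - r]. *)
have half c : upos c -> 2 * r <= N c -> N (r%:C%:A - c) <= N c - r.
  move=> pc hc; pose t := N c / 2.
  have hct : N (t%:C%:A - c) <= t by apply: norm_sub_upos => //; rewrite /t; lra.
  have -> : r%:C%:A - c = (t%:C%:A - c) - (t - r)%:C%:A.
    by rewrite rmorphB scalerBl opprB [RHS]addrC subrKA.
  apply: le_trans (NB _ _) _.
  have := @N1r (t - r); rewrite /t in hct *; rewrite subr_ge0 => /(_ ltac:(lra)); lra.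
have [qr|rq] := leP (N q) (2 * r).
  by rewrite aE; apply: norm_sub_upos.
have [ar|ra] := leP (N a) (2 * r).
  by have := norm_sub_upos pa ar; rewrite -/q; lra.
have := half _ pq (ltW rq); have := half _ pa (ltW ra).
by rewrite -aE -/q; lra.
Qed.

Let upos_anti a : upos a -> upos (- a) -> a = 0.
Proof.
move=> pa pna; apply: (ucs_norm_eq0 hB); apply/eqP; rewrite eq_le N_ge0 andbT.
by have := upos_norm_le pa pna; rewrite subrr N0.
Qed.

Let star_mul_eq0 a : star a * a = 0 -> a = 0.
Proof.
move=> a0; apply: (ucs_norm_eq0 hB); apply/eqP; rewrite -sqrf_eq0 eq_le.
by rewrite exprn_ge0// andbT -N0 -a0 (ucs_norm_cstar hB).
Qed.

(** The sum is half of [s ^+ 2 + d ^+ 2], where the self-adjoint [s] and [d] are, up to sign, twice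
    the real and imaginary parts of [y]. *)
Lemma upos_star_add y : upos (y * star y + star y * y).
Proof.
have l1 a b : a + b - (a - b) = b + b by rewrite opprB addrC subrKA.
have l2 a b : a + b - (- a + b) = a + a.
  by rewrite opprD opprK addrACA subrr addr0.
pose s := y + star y; pose d := 'i%C *: (y - star y).
have ss : star s = s by rewrite starD starK addrC.
have sd : star d = d.
  rewrite starZ starB starK conjE -[star y - y]opprB scalerN -scaleNr.
  by rewrite conj_i opprK.
have -> : y * star y + star y * y = (2^-1)%:C *: (s * s + d * d).
  have -> : s * s + d * d = (2%:R)%:C *: (y * star y + star y * y).
    rewrite /d -scalerAl -scalerAr scalerA ii scaleN1r /s.
    rewrite !(mulrDl, mulrDr) !mulrN !mulNr opprK rmorphD scalerDl !scale1r.
    by rewrite opprD addrACA l1 l2 addrACA.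
  by rewrite scalerA -rmorphM/= mulVf// scale1r.
by apply: uposZ; rewrite ?invr_ge0//; apply: uposD; apply: upos_sq.
Qed.

(* With [m = |h|] for [h = x* x] and [v = m - h], the element [y = x v] has
   [y* y = - e^2] for a self-adjoint [e], and [z = y e] then has both [z* z] and
   [z z*] negative, which forces [z = 0], hence [y = 0] and [v = 0]. *)
Lemma upos_star_mul x : upos (star x * x).
Proof.
set h := star x * x.
have sh : star h = h by rewrite starM starK.
have [m [mm sm pm cm]] := upos_sqrt (upos_sq sh).
have hm : h * m = m * h by apply: cm; rewrite mulrA.
have [g [gg sg _ cg]] := upos_sqrt pm.
have hg : h * g = g * h by apply: cg.
pose v := m - h.
have sv : star v = v by rewrite starB sm sh.
have hv : h * v = - (m * v) by rewrite !mulrBr mm hm opprB.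
have gv : g * v = v * g by rewrite mulrBr mulrBl hg -gg mulrA.
pose e := g * v; have se : star e = e by rewrite /e starM sg sv gv.
pose y := x * v.
have yy : star y * y = - (e * e).
  rewrite /y starM sv mulrA -[v * star x * x]mulrA -/h -mulrA hv mulrN.
  have -> : e * e = v * g * (g * v) by rewrite {1}/e {1}gv.
  by rewrite -gg !mulrA.
pose z := y * e.
have zz : star z * z = - (e * e * (e * e)).
  by rewrite /z starM se mulrA -[e * star y * y]mulrA yy mulrN mulNr !mulrA.
have sn : star (y * star y) = y * star y by rewrite starM starK.
have zz' : z * star z = - (y * star y * (y * star y)).
  rewrite /z starM se [LHS]mulrA -[y * e * e]mulrA -[e * e]opprK -yy.
  by rewrite mulrN mulNr !mulrA.
have pee : upos (e * e * (e * e)) by apply: upos_sq; rewrite starM se.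
have pn : upos (y * star y * (y * star y)) by apply: upos_sq.
(* The sum is positive, and its opposite is [star z * z + z * star z], which is positive too. *)
have S0 : y * star y * (y * star y) + e * e * (e * e) = 0.
  apply: upos_anti; first exact: uposD.
  by rewrite opprD -zz -zz'; apply: upos_star_add.
have y0 : y = 0.
  have n0 : star (y * star y) * (y * star y) = 0.
    apply: (ucs_norm_eq0 hB); apply/eqP; rewrite eq_le N_ge0 andbT sn -N0 -S0.
    exact: upos_norm_le.
  rewrite -[y]starK; apply/eqP; rewrite -(inj_eq (can_inj starK)) starK star0.
  by apply/eqP/star_mul_eq0; rewrite starK; apply: star_mul_eq0.
(* Then [m * v = - (h * v)] vanishes as well, hence so does [v * v = (m - h) * v]. With [v = 0], [h]
   equals its positive modulus [m]. *)
have hv0 : h * v = 0 by rewrite -mulrA -/y y0 mulr0.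
suff v0 : v = 0 by move/eqP: v0; rewrite subr_eq0 => /eqP <-.
apply: star_mul_eq0; rewrite sv {1}/v mulrBl hv0 subr0.
by apply/eqP; rewrite -oppr_eq0 -hv hv0.
Qed.

End UnitalCStar.

(** * The unitization *)

Section Unitization.
Variables (R : realType) (A : cstarAlgType R).
Implicit Types (a b c : A) (k l : R[i]).

Lemma cmul0r a : cmul 0 a = 0 :> A.
Proof. by apply: (addrI (cmul 0 a)); rewrite -cmulDl !addr0. Qed.

Lemma cmulr0 a : cmul a 0 = 0 :> A.
Proof. by apply: (addrI (cmul a 0)); rewrite -cmulDr !addr0. Qed.

Lemma rcnormM a b : rnorm (cmul a b) <= rnorm a * rnorm b.
Proof. by rewrite -lecR rmorphM /= -!rnormE cnormM. Qed.

Lemma rcnorm_star a : rnorm (cmul (cstar a) a) = rnorm a ^+ 2.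
Proof. by apply: complexI; rewrite rmorphXn /= -!rnormE cnorm_star. Qed.

Lemma rcnorm_cstar a : rnorm (cstar a) = rnorm a.
Proof.
have le b : rnorm b <= rnorm (cstar b).
  have [->|b0] := eqVneq (rnorm b) 0; first exact: rnorm_ge0.
  have bp : 0 < rnorm b by rewrite lt_def b0 rnorm_ge0.
  by rewrite -(ler_pM2r bp) -expr2 -rcnorm_star rcnormM.
by apply/eqP; rewrite eq_le le andbT -{2}[a]cstarK le.
Qed.

(** The pair [(k, a)] stands for [k + a]. Only the vector space structure is copied from the
    product, as the multiplication is not componentwise. *)
Definition unitization : Type := (R[i]^o * A)%type.
HB.instance Definition _ := GRing.Lmodule.copy unitization (R[i]^o * A)%type.
Implicit Types x y z : unitization.

Let umul x y : unitization :=
  (x.1 * y.1, (x.1 : R[i]) *: y.2 + (y.1 : R[i]) *: x.2 + cmul x.2 y.2).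
Let uone : unitization := (1, 0).

Let umulA : associative umul.
Proof.
move=> x y z; congr (_, _) => /=; first by rewrite mulrA.
rewrite !scalerDr !cmulDl !cmulDr !cmulZl !cmulZr !scalerA cmulA.
rewrite [z.1 * x.1]mulrC [z.1 * y.1]mulrC.
rewrite -!addrA; congr (_ + (_ + _)).
rewrite [LHS]addrCA; congr (_ + _); rewrite [RHS]addrCA; congr (_ + _).
by rewrite addrCA.
Qed.

Let umul1x : left_id uone umul.
Proof.
by move=> [k a]; congr (_, _); rewrite /= ?mul1r// scale1r scaler0 cmul0r !addr0.
Qed.

Let umulx1 : right_id uone umul.
Proof.
by move=> [k a]; congr (_, _); rewrite /= ?mulr1// scale1r scaler0 cmulr0 add0r addr0.
Qed.

Let umulDl : left_distributive umul +%R.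
Proof.
move=> x y z; congr (_, _) => /=; first by rewrite mulrDl.
by rewrite scalerDl scalerDr cmulDl (addrACA (x.1 *: _)) [LHS]addrACA.
Qed.

Let umulDr : right_distributive umul +%R.
Proof.
move=> x y z; congr (_, _) => /=; first by rewrite mulrDr.
by rewrite scalerDl scalerDr cmulDr (addrACA (x.1 *: _)) [LHS]addrACA.
Qed.

Let uone_neq0 : uone != 0.
Proof. by apply/eqP => -[] /eqP; rewrite oner_eq0. Qed.

HB.instance Definition _ := GRing.Zmodule_isNzRing.Build unitization
  umulA umul1x umulx1 umulDl umulDr uone_neq0.

Let uscaleAl (k : R[i]) x y : k *: (x * y) = (k *: x) * y.
Proof.
congr (_, _) => /=; first by rewrite scalerAl.
by rewrite !scalerDr !scalerA cmulZl [k * y.1]mulrC.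
Qed.
HB.instance Definition _ :=
  GRing.Lmodule_isLalgebra.Build R[i] unitization uscaleAl.

Let uscaleAr (k : R[i]) x y : k *: (x * y) = x * (k *: y).
Proof.
congr (_, _) => /=; first by rewrite scalerAr.
by rewrite !scalerDr !scalerA cmulZr [k * x.1]mulrC.
Qed.
HB.instance Definition _ :=
  GRing.Lalgebra_isAlgebra.Build R[i] unitization uscaleAr.

Definition uemb a : unitization := (0, a).

Lemma uembD a b : uemb (a + b) = uemb a + uemb b.
Proof. by congr (_, _); rewrite /= addr0. Qed.

Lemma uembB a b : uemb (a - b) = uemb a - uemb b.
Proof. by congr (_, _); rewrite /= subr0. Qed.

Lemma uembZ k a : uemb (k *: a) = k *: uemb a.
Proof. by congr (_, _); rewrite /= scaler0. Qed.

Lemma uembM a b : uemb (cmul a b) = uemb a * uemb b.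
Proof. by congr (_, _); rewrite /= ?mul0r// !scale0r !add0r. Qed.

Definition ustar x : unitization := ((x.1^*)%R, cstar x.2).

Lemma ustar_emb a : ustar (uemb a) = uemb (cstar a).
Proof. by congr (_, _); rewrite /= rmorph0. Qed.

(** Left multiplication by [k + a] on the ideal [A]. *)
Definition uact x b : A := (x.1 : R[i]) *: b + cmul x.2 b.

Lemma uactM x y b : uact (x * y) b = uact x (uact y b).
Proof.
rewrite /uact /= scalerDr !cmulDl !cmulDr scalerA -!addrA; congr (_ + _).
by rewrite !cmulZl cmulZr cmulA addrCA.
Qed.

(* The operator norm alone would be only a seminorm when [A] has a unit. *)
Definition unorm x : R :=
  Num.max (rnorm (x.1 : R[i]))
    (sup [set rnorm (uact x b) | b in [set b | rnorm b <= 1]]).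

Let uset x := [set rnorm (uact x b) | b in [set b | rnorm b <= 1]].

Let uact_le x b : rnorm (uact x b) <= (rnorm (x.1 : R[i]) + rnorm x.2) * rnorm b.
Proof.
apply: le_trans (rnormD _ _) _; rewrite rnormZ mulrDl lerD2l.
exact: rcnormM.
Qed.

Let uset_sup x : has_sup (uset x).
Proof.
split; first by exists (rnorm (uact x 0)), 0 => //=; rewrite rnorm0.
exists (rnorm (x.1 : R[i]) + rnorm x.2) => _ [b /= b1 <-].
apply: le_trans (uact_le _ _) _.
by rewrite ler_piMr// addr_ge0// rnorm_ge0.
Qed.

Let uactZ x (k : R[i]) b : uact x (k *: b) = k *: uact x b.
Proof. by rewrite /uact scalerDr cmulZr !scalerA mulrC. Qed.

Lemma rnorm_uact_le x b : rnorm (uact x b) <= unorm x * rnorm b.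
Proof.
have [b0|b0] := eqVneq (rnorm b) 0.
  by rewrite b0 mulr0 (le_trans (uact_le x b))// b0 mulr0.
have bp : 0 < rnorm b by rewrite lt_def b0 rnorm_ge0.
rewrite mulrC -ler_pdivrMl// -[(rnorm b)^-1]rnorm_pos ?invr_ge0 ?(ltW bp)//.
rewrite -rnormZ -uactZ le_max; apply/orP; right.
apply: ub_le_sup; first by have [] := uset_sup x.
exists ((rnorm b)^-1%:C *: b) => //=.
by rewrite rnormZ rnorm_pos ?invr_ge0 ?(ltW bp)// mulVf.
Qed.

Lemma unorm_le x r : rnorm (x.1 : R[i]) <= r ->
  (forall b, rnorm (uact x b) <= r * rnorm b) -> unorm x <= r.
Proof.
move=> x1 H; rewrite /unorm ge_max x1 /=; apply: ge_sup.
  by have [] := uset_sup x.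
move=> _ [b /= b1 <-]; apply: le_trans (H b) _.
by rewrite ler_piMr// (le_trans _ x1)// rnorm_ge0.
Qed.

Lemma rnorm_fst_le x : rnorm (x.1 : R[i]) <= unorm x.
Proof. by rewrite le_max lexx. Qed.

Let unorm_ge0 x : 0 <= unorm x.
Proof. exact: le_trans (rnorm_ge0 _) (rnorm_fst_le x). Qed.

(** The lower bound comes from testing left multiplication by [a] on [cstar a]. *)
Lemma unorm_emb a : unorm (uemb a) = rnorm a.
Proof.
apply/eqP; rewrite eq_le; apply/andP; split.
  apply: unorm_le => [|b] /=; first by rewrite rnorm0 rnorm_ge0.
  by rewrite /uact scale0r add0r rcnormM.
have [->|a0] := eqVneq (rnorm a) 0; first exact: unorm_ge0.
have ap : 0 < rnorm a by rewrite lt_def a0 rnorm_ge0.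
rewrite -(ler_pM2r ap) -expr2 -(rcnorm_cstar a) -rcnorm_star cstarK.
have := rnorm_uact_le (uemb a) (cstar a).
by rewrite /uact scale0r add0r rcnorm_cstar.
Qed.

Let unormD x y : unorm (x + y) <= unorm x + unorm y.
Proof.
apply: unorm_le => [|b].
  by apply: le_trans (rnormD _ _) _; rewrite lerD ?rnorm_fst_le.
have -> : uact (x + y) b = uact x b + uact y b.
  by rewrite /uact /= scalerDl cmulDl addrACA.
by apply: le_trans (rnormD _ _) _; rewrite mulrDl lerD ?rnorm_uact_le.
Qed.

Let unormZ (k : R[i]) x : unorm (k *: x) <= rnorm k * unorm x.
Proof.
apply: unorm_le => [|b].
  by rewrite /= rnormM ler_wpM2l ?rnorm_ge0 ?rnorm_fst_le.
have -> : uact (k *: x) b = k *: uact x b.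
  by rewrite /uact scalerDr scalerA cmulZl.
by rewrite rnormZ -mulrA ler_wpM2l ?rnorm_ge0 ?rnorm_uact_le.
Qed.

Let unormM x y : unorm (x * y) <= unorm x * unorm y.
Proof.
apply: unorm_le => [|b].
  by rewrite /= rnormM ler_pM ?rnorm_ge0 ?rnorm_fst_le.
rewrite uactM; apply: le_trans (rnorm_uact_le _ _) _.
by rewrite -mulrA ler_wpM2l ?rnorm_uact_le.
Qed.

(** For [b] in [A], the square of the norm of [x b] is the norm of [cstar b] times
    [(ustar x * x) b], hence at most [unorm (ustar x * x)] times the square of the norm of [b]. *)
Let unorm_cstar x : unorm x ^+ 2 <= unorm (ustar x * x).
Proof.
rewrite -[leRHS]sqr_sqrtr ?unorm_ge0// ler_sqr ?nnegrE ?sqrtr_ge0//.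
apply: unorm_le => [|b]; rewrite -ler_sqr ?nnegrE ?mulr_ge0 ?rnorm_ge0 ?sqrtr_ge0//.
  rewrite sqr_sqrtr ?unorm_ge0// -rnorm_conjM; exact: (rnorm_fst_le (ustar x * x)).
rewrite exprMn sqr_sqrtr ?unorm_ge0// -rcnorm_star.
have -> : cmul (cstar (uact x b)) (uact x b) = cmul (cstar b) (uact (ustar x * x) b).
  rewrite uactM /uact/= cstarD cstarZ cstarM.
  by rewrite !(cmulDl, cmulDr, cmulZl, cmulZr, cmulA, scalerDr).
apply: le_trans (rcnormM _ _) _; rewrite rcnorm_cstar mulrC expr2 mulrA.
by rewrite ler_wpM2r ?rnorm_ge0 ?rnorm_uact_le.
Qed.

(** Together with [rnorm_fst_le], this lets [unorm] control both components, whence definiteness and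
    completeness. *)
Let snd_le x : rnorm x.2 <= 2 * unorm x.
Proof.
rewrite -unorm_emb; have -> : uemb x.2 = x - (x.1 : R[i]) *: 1.
  by congr (_, _); rewrite /= ?scaler0 ?subr0// /GRing.scale/= mulr1 subrr.
rewrite mulr_natl mulr2n; apply: le_trans (unormD _ _) _; rewrite lerD2l.
rewrite -scaleNr; apply: le_trans (unormZ _ _) _; rewrite rnormN.
apply: le_trans (_ : rnorm (x.1 : R[i]) * 1 <= _); last by rewrite mulr1 rnorm_fst_le.
rewrite ler_wpM2l ?rnorm_ge0//; apply: unorm_le => [|b].
  by rewrite /= rnorm_pos.
by rewrite /uact/= scale1r cmul0r addr0 mul1r.
Qed.

Let unorm_le_add x : unorm x <= rnorm (x.1 : R[i]) + rnorm x.2.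
Proof.
apply: unorm_le => [|b]; last exact: uact_le.
by rewrite lerDl rnorm_ge0.
Qed.

Lemma unitization_unital_cstar : @unital_cstar R unitization ustar unorm.
Proof.
split=> //.
- by move=> x; rewrite /ustar /= conjCK cstarK; case: x.
- by move=> x y; congr (_, _); rewrite /= ?rmorphD// cstarD.
- by move=> k x; congr (_, _); rewrite /= ?rmorphM// cstarZ.
- move=> x y; congr (_, _); rewrite /=; first by rewrite rmorphM mulrC.
  by rewrite !cstarD !cstarZ cstarM [in RHS](addrC (_ *: _)).
- apply: unorm_le => [|b]; first by rewrite /= rnorm_pos.
  by rewrite /uact/= scale1r cmul0r addr0 mul1r.
- move=> x x0; have x1 : x.1 = 0.
    apply: rnorm_eq0; apply/eqP; rewrite eq_le rnorm_ge0 andbT.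
    by rewrite -x0 rnorm_fst_le.
  have x2 : x.2 = 0.
    apply: rnorm_eq0; apply/eqP; rewrite eq_le rnorm_ge0 andbT.
    by have := snd_le x; rewrite x0 mulr0.
  by rewrite [x]surjective_pairing x1 x2.
- move=> u cu.
  have [l ul] : exists l, cvg_for (@rnorm R R[i]) (fun n => (u n).1) l.
    apply: complex_cvg => e /cu[n0 H]; exists n0 => m n hm hn.
    exact: le_lt_trans (rnorm_fst_le _) (H _ _ hm hn).
  have [a ua] : exists a, cvg_for (@rnorm R A) (fun n => (u n).2) a.
    apply: completeNormedModule_cvg => e e0.
    have [|n0 H] := cu (e / 2); first by rewrite divr_gt0.
    exists n0 => m n hm hn; apply: le_lt_trans (snd_le (u m - u n)) _.
    by have := H _ _ hm hn; rewrite ltr_pdivlMr// mulrC.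
  exists ((l, a) : unitization) => e e0; have e20 : 0 < e / 2 by rewrite divr_gt0.
  have [n1 H1] := ul _ e20; have [n2 H2] := ua _ e20.
  exists (maxn n1 n2) => n; rewrite geq_max => /andP[h1 h2].
  apply: le_lt_trans (unorm_le_add _) _; rewrite [ltRHS]splitr.
  by apply: ltrD; [apply: H1|apply: H2].
Qed.

End Unitization.

(** * Hermitian and Hilbert modules *)

Section Positive.
Variables (R : realType) (A : cstarAlgType R).
Implicit Types (a b c : A).

(** Positivity in [A] is read in the unitization, where scalars can be subtracted from elements. *)
Definition apos a := upos (@ustar R A) (@unorm R A) (uemb a).

Let hU := unitization_unital_cstar A.

Lemma aposD a b : apos a -> apos b -> apos (a + b).
Proof. by rewrite /apos uembD; apply: uposD. Qed.

Lemma aposZ (t : R) a : 0 <= t -> apos a -> apos (t%:C *: a).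
Proof. by rewrite /apos uembZ; apply: uposZ. Qed.

Lemma apos_mul_star a : apos (cmul a (cstar a)).
Proof.
by rewrite /apos uembM -[X in uemb X * _]cstarK -ustar_emb; apply: upos_star_mul.
Qed.

Lemma apos_cpositive a : cpositive a -> apos a.
Proof. by move=> [b ->]; rewrite -[X in cmul _ X]cstarK; apply: apos_mul_star. Qed.

Lemma apos_le_norm a b : apos a -> apos b -> rnorm a <= rnorm (a + b).
Proof. by move=> pa pb; rewrite -!unorm_emb uembD; apply: (upos_norm_le hU). Qed.

(** With [k] the root of [s - c] in the unitization, the element is [star x * x] for
    [x = k * cstar a]. *)
Lemma apos_conj_sub (s : R) a c : cstar c = c -> rnorm c <= s ->
  apos (s%:C *: cmul a (cstar a) - cmul (cmul a c) (cstar a)).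
Proof.
move=> sc cs.
have [||k [kk sk _ _]] := upos_sqrt hU (upos_shift hU (t := s) (a := uemb c) _ _).
- by rewrite ustar_emb sc.
- by rewrite unorm_emb.
have -> : apos (s%:C *: cmul a (cstar a) - cmul (cmul a c) (cstar a)) =
   upos (@ustar R A) (@unorm R A) (ustar (k * uemb (cstar a)) * (k * uemb (cstar a))).
  rewrite (ucs_starM hU) ustar_emb cstarK sk mulrA -[_ * k * k]mulrA kk.
  by rewrite mulrBr mulr_algr mulrBl -scalerAl -!uembM -uembZ -uembB.
exact: upos_star_mul.
Qed.

End Positive.

(** * Inner products, Cauchy-Schwarz and the triangle inequality *)

Section HermitianModule.
Variables (R : realType) (A : cstarAlgType R) (E : hermitianModType A).
Implicit Types (x y z : E).

Lemma innerDr x y z : inner x (y + z) = inner x y + inner x z :> A.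
Proof. by rewrite -inner_star innerDl cstarD !inner_star. Qed.

Lemma innerZr (k : R[i]) x y : inner x (k *: y) = (k^*)%R *: inner x y :> A.
Proof. by rewrite -inner_star innerZl cstarZ inner_star. Qed.

Lemma inner_actr (a : A) x y : inner x (act a y) = cmul (inner x y) (cstar a) :> A.
Proof. by rewrite -inner_star inner_act cstarM inner_star. Qed.

Lemma innerNl x y : inner (- x) y = - inner x y :> A.
Proof. by rewrite -scaleN1r innerZl scaleN1r. Qed.

Lemma innerNr x y : inner x (- y) = - inner x y :> A.
Proof. by rewrite -scaleN1r innerZr rmorphN1 scaleN1r. Qed.

Lemma innerBl x y z : inner (x - y) z = inner x z - inner y z :> A.
Proof. by rewrite innerDl innerNl. Qed.

Lemma innerBr x y z : inner x (y - z) = inner x y - inner x z :> A.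
Proof. by rewrite innerDr innerNr. Qed.

(** A separate hypothesis, because the direct sum is only declared as a hermitian module; [psd_sum]
    provides it there. *)
Definition psd := forall x, apos (inner x x : A).

Lemma hnorm_ge0 x : 0 <= hnorm x.
Proof. exact: sqrtr_ge0. Qed.

Lemma hnorm_sqr x : hnorm x ^+ 2 = rnorm (inner x x : A).
Proof. by rewrite sqr_sqrtr// rnorm_ge0. Qed.

Lemma hnormZ (k : R[i]) x : hnorm (k *: x) = rnorm k * hnorm x.
Proof.
apply/eqP; rewrite -(@eqrXn2 _ 2) ?mulr_ge0 ?hnorm_ge0 ?rnorm_ge0//.
rewrite exprMn !hnorm_sqr innerZl innerZr !rnormZ mulrA.
by rewrite rnorm_conj -expr2.
Qed.

Lemma hnormN x : hnorm (- x) = hnorm x.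
Proof. by rewrite /hnorm innerNl innerNr opprK. Qed.

Lemma hnorm0 : hnorm (0 : E) = 0.
Proof. by rewrite -(scale0r 0) hnormZ rnorm0 mul0r. Qed.

Hypothesis hE : psd.

(* Positivity of [<z, z>] for [z = x - s^-1 <x, y> y] with [s > |<y, y>|]. *)
Lemma norm_inner_le x y : rnorm (inner x y : A) <= hnorm x * hnorm y.
Proof.
rewrite -ler_sqr ?nnegrE ?rnorm_ge0 ?mulr_ge0 ?hnorm_ge0// exprMn !hnorm_sqr.
set a := inner x y; set nx := rnorm (inner x x); set ny := rnorm (inner y y).
have nx0 : 0 <= nx by exact: rnorm_ge0.
have key s : ny < s -> rnorm a ^+ 2 <= s * nx.
  move=> ns; have s0 : 0 < s by apply: le_lt_trans ns; exact: rnorm_ge0.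
  pose w := s^-1%:C *: act a y; pose aa := cmul a (cstar a).
  have sx : inner x w = s^-1%:C *: aa by rewrite innerZr conjE conjc_real inner_actr.
  have swx : inner w x = s^-1%:C *: aa by rewrite innerZl inner_act -inner_star.
  have sww : inner w w = s^-1%:C *: (s^-1%:C *: cmul (cmul a (inner y y)) (cstar a)).
    by rewrite innerZl innerZr conjE conjc_real inner_act inner_actr cmulA.
  have pQ : apos (s%:C *: aa - cmul (cmul a (inner y y)) (cstar a)).
    by apply: apos_conj_sub; [exact: inner_star|exact: ltW].
  have si : 0 <= s^-1 by rewrite invr_ge0 ltW.
  (* This writes [inner x x] as [s^-1 aa] plus two positive terms, so its norm dominates that of
     [s^-1 aa]. *)
  have E1 : s^-1%:C *: aa + (inner (x - w) (x - w) +
      s^-1%:C *: (s^-1%:C *: (s%:C *: aa - cmul (cmul a (inner y y)) (cstar a))))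
      = inner x x.
    rewrite innerBl !innerBr sx swx sww !scalerBr [s^-1%:C *: (s%:C *: _)]scalerA.
    rewrite -rmorphM/= mulVf ?gt_eqF// scale1r.
    set b := s^-1%:C *: aa; set d := s^-1%:C *: (_ *: _).
    by rewrite subrK addrC subrK.
  have : rnorm (s^-1%:C *: aa) <= nx.
    rewrite /nx -E1; apply: apos_le_norm; first exact/aposZ/apos_mul_star.
    by apply: aposD; [exact: hE|apply: aposZ => //; apply: aposZ].
  rewrite rnormZ rnorm_pos// ler_pdivrMl// /aa -[X in cmul X _]cstarK rcnorm_star.
  by rewrite rcnorm_cstar.
apply/ler_addgt0Pr => e e0.
apply: le_trans (key (ny + e / (nx + 1)) _) _.
  by rewrite ltrDl divr_gt0 // ltr_wpDl.
rewrite mulrDl mulrC lerD2l -mulrA ler_piMr ?(ltW e0)//.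
by rewrite mulrC ler_pdivrMr ?ltr_wpDl// mul1r lerDl.
Qed.

Lemma hnormD x y : hnorm (x + y) <= hnorm x + hnorm y.
Proof.
rewrite -ler_sqr ?nnegrE ?addr_ge0 ?hnorm_ge0// hnorm_sqr innerDl !innerDr.
have h1 := rnormD (inner x x + inner x y : A) (inner y x + inner y y).
have h2 := rnormD (inner x x : A) (inner x y).
have h3 := rnormD (inner y x : A) (inner y y).
have := norm_inner_le x y; have := norm_inner_le y x.
move: h2 h3; rewrite -!hnorm_sqr; lra.
Qed.

Lemma hnormB x y : hnorm (x - y) <= hnorm x + hnorm y.
Proof. by rewrite -(hnormN y) hnormD. Qed.

End HermitianModule.

(** * Completeness and fixed points in Hilbert modules *)

Section HilbertModule.
Variables (R : realType) (A : cstarAlgType R).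

Lemma psd_hilbert (E : hilbertModType A) : psd E.
Proof. by move=> x; apply/apos_cpositive/inner_pos. Qed.

Lemma psd_sum (E F : hermitianModType A) : psd E -> psd F -> psd (E * F)%type.
Proof. by move=> hE hF x; apply: aposD; [exact: hE|exact: hF]. Qed.

Lemma hnorm_eq0 (E : hilbertModType A) (x : E) : hnorm x = 0 -> x = 0.
Proof.
move=> x0; apply: (@inner_eq0 R A); apply: rnorm_eq0.
by rewrite -hnorm_sqr x0 expr0n.
Qed.

Lemma inner_inj (E : hilbertModType A) (x y : E) :
  (forall z : E, inner z x = inner z y :> A) -> x = y.
Proof.
move=> h; apply/eqP; rewrite -subr_eq0; apply/eqP/(@inner_eq0 R A).
by rewrite innerBr h subrr.
Qed.

Lemma expr_lt (q e : R) : 0 <= q -> q < 1 -> 0 < e -> exists n, q ^+ n < e.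
Proof.
move=> q0 q1 e0; have : (fun n => q ^+ n) @ \oo --> (0 : R).
  by apply: cvg_expr; rewrite ger0_norm.
move/cvgrPdist_lt => /(_ _ e0) [n _ /(_ n (leqnn n))] /=.
by rewrite sub0r normrN ger0_norm ?exprn_ge0//; exists n.
Qed.

(** The bound on an increment is [C * q ^+ n - C * q ^+ n.+1], so the sums telescope and the limit
    comes with an explicit rate. *)
Lemma hilbert_geometric (E : hilbertModType A) (u : nat -> E) (C q : R) :
  0 <= C -> 0 <= q -> q < 1 ->
  (forall n, hnorm (u n.+1 - u n) <= C * (1 - q) * q ^+ n) ->
  exists l, forall n, hnorm (u n - l) <= C * q ^+ n.
Proof.
move=> C0 q0 q1 H; have hE := @psd_hilbert E.
have D n m : hnorm (u (n + m)%N - u n) <= C * q ^+ n - C * q ^+ (n + m).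
  elim: m => [|m IH]; first by rewrite addn0 !subrr hnorm0.
  rewrite addnS -(subrKA (u (n + m)%N)); apply: le_trans (hnormD hE _ _) _.
  by have := H (n + m)%N; rewrite [q ^+ (n + m).+1]exprS; lra.
have D' n m : (n <= m)%N -> hnorm (u m - u n) <= C * q ^+ n.
  move=> /subnKC <-; apply: le_trans (D _ _) _.
  by rewrite gerBl mulr_ge0// exprn_ge0.
have [l ul] : exists l, cvg_for (@hnorm R A E) u l.
  apply: hnorm_complete => e e0.
  have [|n0 hn0] := @expr_lt q (e / (C + 1)) q0 q1; first by rewrite divr_gt0// ltr_wpDl.
  have hC : C * q ^+ n0 < e.
    move: hn0; rewrite ltr_pdivlMr ?ltr_wpDl//; apply: le_lt_trans.
    by rewrite mulrC ler_wpM2l ?exprn_ge0// lerDl.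
  exists n0 => m n hm hn.
  wlog nm : m n hm hn / (n <= m)%N.
    move=> W; have [|/ltnW mn] := leqP n m; first exact: W.
    by rewrite -hnormN opprB; apply: W.
  apply: le_lt_trans (D' _ _ nm) _; apply: le_lt_trans hC.
  by rewrite ler_wpM2l// ler_wiXn2l// ltW.
exists l => n; apply/ler_addgt0Pr => e /ul[m0 hm0].
rewrite -(subrKA (u (n + m0)%N)); apply: le_trans (hnormD hE _ _) _.
apply: lerD; last by apply/ltW/hm0; rewrite leq_addl.
by rewrite -hnormN opprB D' // leq_addr.
Qed.

(** Banach's fixed point theorem for [hnorm], by iteration from 0. *)
Lemma hilbert_contraction (E : hilbertModType A) (f : E -> E) (q : R) :
  0 <= q -> q < 1 -> (forall x y, hnorm (f x - f y) <= q * hnorm (x - y)) ->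
  exists x, f x = x.
Proof.
move=> q0 q1 H; have hE := @psd_hilbert E.
pose u n := iter n f 0; have q1' : 0 < 1 - q by rewrite subr_gt0.
pose C := hnorm (u 1 - u 0) / (1 - q).
have C0 : 0 <= C by rewrite divr_ge0 ?hnorm_ge0// ltW.
have [n|l hl] := @hilbert_geometric E u C q C0 q0 q1.
  rewrite divfK ?gt_eqF//; elim: n => [|n IH]; first by rewrite expr0 mulr1.
  apply: le_trans (H _ _) _; rewrite exprS mulrCA.
  exact: ler_wpM2l.
exists l; apply/eqP; rewrite -subr_eq0; apply/eqP/hnorm_eq0/eqP.
rewrite eq_le hnorm_ge0 andbT; apply/ler_addgt0Pr => e e0; rewrite add0r.
(* Both [f l - u n.+1] and [u n.+1 - l] have norm at most [C * q ^+ n]; the extra 1 keeps the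
   divisor positive. *)
have C1 : 0 < 2 * C + 1 by rewrite ltr_wpDl// mulr_ge0.
have [|n hn] := @expr_lt q (e / (2 * C + 1)) q0 q1; first by rewrite divr_gt0.
rewrite -(subrKA (u n.+1)); apply: le_trans (hnormD hE _ _) _.
have h1 := hl n.+1; have h2 := H l (u n); have h3 := hl n.
rewrite -hnormN opprB in h3.
move: hn; rewrite ltr_pdivlMr// => hn.
have qn : 0 <= q ^+ n by rewrite exprn_ge0.
have : C * q ^+ n.+1 <= C * q ^+ n by rewrite ler_wpM2l// ler_wiXn2l// ltW.
have : q * hnorm (l - u n) <= hnorm (l - u n) by rewrite ler_piMl ?hnorm_ge0// ltW.
rewrite /u iterS -/(u n) in h1 *.
lra.
Qed.

End HilbertModule.

(** * Adjointable operators *)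

Section Adjointable.
Variables (R : realType) (A : cstarAlgType R).

HB.instance Definition _ (E F : hermitianModType A) (T : adjointable E F) :=
  GRing.isLinear.Build R[i] E F _ (adj_fun T) (adj_linear T).

(** A bound that makes sense before the supremum in [opnorm] is known to be finite. *)
Definition bounded_by (E F : hermitianModType A) (T : E -> F) (c : R) :=
  forall x, hnorm (T x) <= c * hnorm x.

Lemma opnorm_le (E F : hermitianModType A) (T : E -> F) c :
  0 <= c -> bounded_by T c -> opnorm T <= c.
Proof.
move=> c0 Tc; apply: ge_sup.
  by exists (hnorm (T 0)), 0 => //=; rewrite hnorm0.
by move=> _ [x /= x1 <-]; apply: le_trans (Tc x) _; rewrite ler_piMr.
Qed.

Lemma opnorm_ge0 (E F : hermitianModType A) (T : E -> F) : 0 <= opnorm T.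
Proof.
have [hs|hs] :=
  pselect (has_sup [set hnorm (T x) | x in [set x : E | hnorm x <= 1]]).
  apply: le_trans (hnorm_ge0 (T 0)) _; apply: ub_le_sup; first by case: hs.
  by exists 0 => //=; rewrite hnorm0.
(* Without a finite supremum, [sup] takes its default value 0. *)
by rewrite /opnorm sup_out.
Qed.

(** Normalization to the unit ball fails for vectors of norm 0, which may be nonzero in a hermitian
    module; they get their own hypothesis. *)
Lemma bounded_by_ball (E F : hermitianModType A) (T : E -> F) M :
  (forall (k : R[i]) x, T (k *: x) = k *: T x) ->
  (forall x, hnorm x = 0 -> hnorm (T x) = 0) ->
  (forall x, hnorm x <= 1 -> hnorm (T x) <= M) -> bounded_by T M.
Proof.
move=> TZ T0 TM x; have [x0|x0] := eqVneq (hnorm x) 0.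
  by rewrite T0 // x0 mulr0.
have xp : 0 < hnorm x by rewrite lt_def x0 hnorm_ge0.
have xV : 0 <= (hnorm x)^-1 by rewrite invr_ge0 ltW.
have := TM ((hnorm x)^-1%:C *: x).
rewrite TZ !hnormZ rnorm_pos// mulVf// => /(_ (lexx _)).
by rewrite ler_pdivrMl// mulrC.
Qed.

Lemma bounded_by_opnorm (E F : hermitianModType A) (T : E -> F) c :
  (forall (k : R[i]) x, T (k *: x) = k *: T x) -> 0 <= c ->
  bounded_by T c -> bounded_by T (opnorm T).
Proof.
move=> TZ c0 Tc; apply: bounded_by_ball => // x hx.
  by apply/eqP; rewrite eq_le hnorm_ge0 andbT; have := Tc x; rewrite hx mulr0.
apply: ub_le_sup; last by exists x.
by exists c => _ [y /= y1 <-]; apply: le_trans (Tc y) _; rewrite ler_piMr.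
Qed.

(** Cauchy-Schwarz applied to [inner x (T' (T x))], whose norm is the square of [hnorm (T x)]. *)
Lemma bounded_by_adjoint (E F : hermitianModType A) (T : E -> F) (T' : F -> E) c :
  psd E -> 0 <= c -> (forall x y, inner (T x) y = inner x (T' y) :> A) ->
  bounded_by T' c -> bounded_by T c.
Proof.
move=> hE c0 TT' T'c x.
have [t0|t0] := eqVneq (hnorm (T x)) 0; first by rewrite t0 mulr_ge0 ?hnorm_ge0.
have tp : 0 < hnorm (T x) by rewrite lt_def t0 hnorm_ge0.
rewrite -(ler_pM2r tp) -expr2 hnorm_sqr TT'.
apply: le_trans (norm_inner_le hE _ _) _.
by rewrite mulrC mulrAC; apply: ler_wpM2r (T'c _); apply: hnorm_ge0.
Qed.

(* Uniform boundedness by a gliding hump: were [T] unbounded on the unit ball,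
   [l] could be built so that [<l, T y_n>] is large while [<T' l, y_n>] is not. *)
Lemma adjointable_bounded (E F : hilbertModType A) (T : adjointable E F) :
  exists2 c, 0 <= c & bounded_by T c.
Proof.
have hE := @psd_hilbert R A E; have hF := @psd_hilbert R A F.
apply: contrapT => nb; pose q : R := 3^-1.
have q0 : 0 < q by rewrite invr_gt0.
have /choice[y hy] : forall n : nat, exists y,
    hnorm y <= 1 /\ n%:R < q ^+ n * hnorm (T y).
  move=> n; apply: contrapT => H; apply: nb; exists (n%:R / q ^+ n).
    by rewrite divr_ge0// exprn_ge0// ltW.
  apply: bounded_by_ball => [k x|x /hnorm_eq0 ->|x x1]; first exact: linearZ.
    by rewrite linear0 hnorm0.
  rewrite ler_pdivlMr ?exprn_gt0// mulrC leNgt; apply/negP => x2.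
  by apply: H; exists x.
pose t n := hnorm (T (y n)).
have t0 n : 0 < t n.
  have [_ h] := hy n; have := le_lt_trans (ler0n _ n) h.
  by rewrite pmulr_rgt0// exprn_gt0.
pose w n : F := (q ^+ n / t n)%:C *: T (y n).
have qt n : 0 <= q ^+ n / t n by rewrite divr_ge0 ?exprn_ge0 ?ltW.
have wn n : hnorm (w n) = q ^+ n by rewrite hnormZ rnorm_pos// divfK ?gt_eqF ?t0.
have wT n : rnorm (inner (w n) (T (y n)) : A) = q ^+ n * t n.
  by rewrite innerZl rnormZ rnorm_pos// -hnorm_sqr -/(t n) expr2 mulrA divfK ?gt_eqF ?t0.
(* The sign is chosen so that the hump survives: the pairings of [x + w n] and [x - w n] with
   [T (y n)] differ by twice [inner (w n) (T (y n))], so one of them is large. *)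
pose g n x := if q ^+ n * t n <= rnorm (inner (x + w n) (T (y n)) : A)
              then x + w n else x - w n.
have gT n x : q ^+ n * t n <= rnorm (inner (g n x) (T (y n)) : A).
  rewrite /g; case: ifP => // /negbT; rewrite -ltNge => h.
  have : rnorm (inner (w n) (T (y n)) + inner (w n) (T (y n)) : A) <=
      rnorm (inner (x + w n) (T (y n)) : A) + rnorm (inner (x - w n) (T (y n)) : A).
    rewrite -[X in _ <= _ + X]rnormN; apply: le_trans (rnormD _ _).
    by rewrite innerDl innerBl opprB [X in _ <= rnorm X]addrC subrKA.
  rewrite -mulr2n -scaler_nat rnormZ wT.
  have -> : rnorm (2%:R : R[i]) = 2 by rewrite -(rmorph_nat (real_complex R)) rnorm_pos.
  lra.
pose xs n := iteri n g 0.
(* Here [3 / 2 = (1 - q)^-1], which turns the bound on the increments into [q ^+ n]. *)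
have [|||n|l hl] := @hilbert_geometric R A F xs (3 / 2) q _ _ _ _.
- by rewrite divr_ge0.
- exact: ltW.
- by rewrite invf_lt1 // ltr1n.
- have -> : 3 / 2 * (1 - q) * q ^+ n = q ^+ n by rewrite /q; field.
  rewrite /xs /= /g; case: ifP => _; rewrite addrAC subrr add0r ?hnormN wn //.
have [T' TT'] := adj_ex T.
pose n := (Num.trunc (2 * hnorm (T' l))).+1.
have hn : 2 * hnorm (T' l) < n%:R.
  by apply: truncnS_gt.
have [y1 y2] := hy n.
have h1 : rnorm (inner l (T (y n)) : A) <= hnorm (T' l).
  rewrite -inner_star rcnorm_cstar TT'; apply: le_trans (norm_inner_le hE _ _) _.
  by rewrite ler_piMl ?hnorm_ge0.
have h2 := gT n (xs n); rewrite -/(xs n.+1) in h2.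
(* The tail after step [n] takes away at most half of the hump, so [inner l (T (y n))] has norm at
   least [q ^+ n * t n / 2 > n / 2], above the bound [hnorm (T' l)]. *)
have h3 : rnorm (inner (xs n.+1 - l) (T (y n)) : A) <= 2^-1 * (q ^+ n * t n).
  apply: le_trans (norm_inner_le hF _ _) _; rewrite mulrA ler_wpM2r ?hnorm_ge0//.
  apply: le_trans (hl n.+1) _; rewrite exprS /q.
  by rewrite le_eqVlt; apply/orP; left; apply/eqP; field.
have h4 := rnormD (inner (xs n.+1 - l) (T (y n)) : A) (inner l (T (y n))).
rewrite -innerDl subrK in h4.
by move: y2; rewrite -/(t n); lra.
Qed.

(** [adj_ex] gives a bare function; definiteness of the inner product makes it linear and
    [A]-linear. *)
Lemma adjoint_ex (E F : hilbertModType A) (T : adjointable E F) :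
  exists T' : adjointable F E, forall x y, inner (T x) y = inner x (T' y) :> A.
Proof.
have [T' TT'] := adj_ex T.
have lT' : linear T'.
  by move=> k x y; apply: inner_inj => z;
    rewrite -TT' innerDr innerZr !TT' innerDr innerZr.
have aT' (a : A) y : T' (act a y) = act a (T' y).
  by apply: inner_inj => z; rewrite -TT' !inner_actr TT'.
have eT' : exists T'' : E -> F, forall x y, inner (T' x) y = inner x (T'' y) :> A.
  by exists T => x y; rewrite -inner_star -TT' inner_star.
by exists (Adjointable lT' aT' eT').
Qed.

(** A fixed point of [f] solves the equation. The Lipschitz constant of [f] is the square root of
    [1 - s], since [(1 - s) ^+ 2 + s ^+ 2 * C ^+ 2 = 1 - s] for the chosen [s]. *)
Lemma id_add_adj_mul_surj (E F : hilbertModType A) (T : adjointable E F)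
    (T' : adjointable F E) : (forall x y, inner (T x) y = inner x (T' y) :> A) ->
  forall y, exists u, u + T' (T u) = y.
Proof.
move=> TT' y; have hE := @psd_hilbert R A E; have hF := @psd_hilbert R A F.
have [c c0 Tc] := adjointable_bounded T; have [d d0 Td] := adjointable_bounded T'.
pose C := d * c; have C0 : 0 <= C by rewrite mulr_ge0.
have KC x : hnorm (T' (T x)) <= C * hnorm x.
  by apply: le_trans (Td _) _; rewrite -mulrA ler_wpM2l.
pose s : R := (1 + C ^+ 2)^-1.
have C1 : 0 < 1 + C ^+ 2 by rewrite ltr_pwDl// exprn_ge0.
have s0 : 0 < s by rewrite invr_gt0.
have s1 : s <= 1 by rewrite invf_le1// lerDl exprn_ge0.
have sC : s * (1 + C ^+ 2) = 1 by rewrite mulVf// gt_eqF.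
pose f x := x - s%:C *: (x + T' (T x) - y).
have fE x x' : f x - f x' = (1 - s)%:C *: (x - x') - s%:C *: T' (T (x - x')).
  have sub2 (a b b1 b2 : E) : a - b - (b1 - b2) = a - b1 - (b - b2).
    by rewrite !opprB [LHS]addrACA [RHS]addrACA (addrC (- b)).
  rewrite /f sub2 -scalerBr opprB subrKA opprD addrACA -!linearB/= scalerDr opprD addrA.
  by rewrite rmorphB scalerBl scale1r.
have key x : hnorm ((1 - s)%:C *: x - s%:C *: T' (T x)) ^+ 2 <= (1 - s) * hnorm x ^+ 2.
  set z := _ - _.
  have KE : inner x (T' (T x)) = inner (T x) (T x) :> A by rewrite TT'.
  have KE' : inner (T' (T x)) x = inner (T x) (T x) :> A.
    by rewrite -inner_star KE inner_star.
  have zE : inner z z + (2 * (s * (1 - s)))%:C *: inner (T x) (T x) =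
     ((1 - s) ^+ 2)%:C *: inner x x + (s ^+ 2)%:C *: inner (T' (T x)) (T' (T x)) :> A.
    rewrite /z innerBl !innerBr !innerZl !innerZr !conjE !conjc_real KE KE'.
    rewrite !scalerA -!rmorphM/= -!expr2 mulr_natl mulr2n rmorphD scalerDl.
    rewrite [(1 - s) * s]mulrC; set b := _ *: inner (T x) _.
    by rewrite opprB addrACA !subrK.
  rewrite hnorm_sqr.
  apply: le_trans (@apos_le_norm _ _ _ ((2 * (s * (1 - s)))%:C *: inner (T x) (T x))
    _ _) _.
  - exact: hE.
  - by apply: aposZ; [rewrite !mulr_ge0// ?subr_ge0// ltW|exact: hF].
  rewrite zE; apply: le_trans (rnormD _ _) _.
  rewrite !rnormZ !rnorm_pos ?exprn_ge0 ?subr_ge0 ?(ltW s0)// -!hnorm_sqr.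
  have : hnorm (T' (T x)) ^+ 2 <= C ^+ 2 * hnorm x ^+ 2.
    by rewrite -exprMn ler_sqr ?nnegrE ?mulr_ge0 ?hnorm_ge0.
  have := exprn_ge0 2 (hnorm_ge0 x).
  set n := hnorm x ^+ 2; set m := hnorm _ ^+ 2 => n0 mn.
  have : s ^+ 2 * m <= s ^+ 2 * (C ^+ 2 * n) by rewrite ler_wpM2l// exprn_ge0// ltW.
  have -> : s ^+ 2 * (C ^+ 2 * n) = (s * (s * (1 + C ^+ 2)) - s ^+ 2) * n by ring.
  by rewrite sC mulr1; lra.
have q1 : Num.sqrt (1 - s) < 1.
  by rewrite -[ltRHS]sqrtr1 ltr_sqrt// gtrBl.
have [x x'|u fu] := @hilbert_contraction R A E f (Num.sqrt (1 - s)) (sqrtr_ge0 _) q1.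
  rewrite fE -ler_sqr ?nnegrE ?mulr_ge0 ?sqrtr_ge0 ?hnorm_ge0//.
  by rewrite exprMn [Num.sqrt (1 - s) ^+ 2]sqr_sqrtr ?subr_ge0// key.
exists u; apply/eqP; rewrite -subr_eq0.
move/eqP: fu; rewrite /f -[X in _ == X]addr0 (inj_eq (addrI u)) oppr_eq0 scaler_eq0.
by case/orP=> // /eqP[s00]; rewrite s00 ltxx in s0.
Qed.

End Adjointable.

(** * Projections on graphs *)

Section OrthogonalProjection.
Variables (R : realType) (A : cstarAlgType R).

(** Cauchy-Schwarz applied to [inner (P x) (P x) = inner x (P x)]. *)
Lemma selfadj_idem_le (E : hermitianModType A) (P : E -> E) : psd E ->
  (forall x, P (P x) = P x) ->
  (forall x y, inner (P x) y = inner x (P y) :> A) ->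
  forall x, hnorm (P x) <= hnorm x.
Proof.
move=> hE PP sP x.
have [p0|p0] := eqVneq (hnorm (P x)) 0; first by rewrite p0 hnorm_ge0.
have pp : 0 < hnorm (P x) by rewrite lt_def p0 hnorm_ge0.
by rewrite -(ler_pM2r pp) -expr2 hnorm_sqr sP PP; apply: norm_inner_le.
Qed.

Lemma selfadj_idem_compl_le (E : hermitianModType A) (P : adjointable E E) :
  psd E -> (forall x, P (P x) = P x) ->
  (forall x y, inner (P x) y = inner x (P y) :> A) ->
  forall x, hnorm (x - P x) <= hnorm x.
Proof.
move=> hE PP sP; apply: (selfadj_idem_le (P := fun x => x - P x)) => // [x|x y].
  by rewrite linearB/= PP subrr subr0.
by rewrite innerBl innerBr sP.
Qed.

Variables (E F : hilbertModType A).
Implicit Types (T S : adjointable E F) (P Q : adjointable (E * F)%type (E * F)%type).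

Let hE : psd E := @psd_hilbert R A E.
Let hF : psd F := @psd_hilbert R A F.
Let hEF : psd (E * F)%type := psd_sum hE hF.

Lemma hnorm_fst_le (z : E * F) : hnorm z.1 <= hnorm z.
Proof.
rewrite -ler_sqr ?nnegrE ?hnorm_ge0// !hnorm_sqr.
exact: (apos_le_norm (hE _) (hF _)).
Qed.

Lemma hnorm_snd_le (z : E * F) : hnorm z.2 <= hnorm z.
Proof.
rewrite -ler_sqr ?nnegrE ?hnorm_ge0// !hnorm_sqr [inner z z]addrC.
exact: (apos_le_norm (hF _) (hE _)).
Qed.

Lemma hnorm_pair_le (x : E) (y : F) : hnorm ((x, y) : E * F) <= hnorm x + hnorm y.
Proof.
rewrite -ler_sqr ?nnegrE ?addr_ge0 ?hnorm_ge0// hnorm_sqr.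
apply: le_trans (rnormD (inner x x : A) (inner y y)) _.
have := hnorm_ge0 x; have := hnorm_ge0 y; rewrite -!hnorm_sqr.
set a := hnorm x; set b := hnorm y => b0 a0.
by have := mulr_ge0 a0 b0; lra.
Qed.

(** The point [(u, T u)] has [z - (u, T u)] orthogonal to the graph exactly when
    [u + T' (T u) = z.1 + T' z.2], which is solvable. *)
Lemma graph_projection_ex T :
  exists P, orthogonal_projection (graph T) P.
Proof.
have [T' TT'] := adjoint_ex T.
have /choice[u uE] : forall z : E * F, exists u : E, u + T' (T u) = z.1 + T' z.2.
  by move=> z; apply: id_add_adj_mul_surj.
pose p (z : E * F) : E * F := (u z, T (u z)).
have orth z x : inner ((x, T x) : E * F) (p z) = inner ((x, T x) : E * F) z :> A.
  by rewrite /inner/= !TT' -!innerDr uE.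
(* Orthogonality determines the point of the graph; linearity, [A]-linearity and idempotence of [p]
   all follow from this. *)
have uniq x z : (forall x', inner ((x', T x') : E * F) ((x, T x) : E * F) =
    inner ((x', T x') : E * F) z :> A) -> p z = (x, T x).
  move=> H; pose d := u z - x.
  have dd : inner ((d, T d) : E * F) ((d, T d) : E * F) = 0 :> A.
    have -> : ((d, T d) : E * F) = p z - (x, T x) by rewrite /d linearB.
    rewrite [RHS]/= innerBr.
    have -> : p z - (x, T x) = (d, T d) by rewrite /d linearB.
    by rewrite orth H subrr.
  have d0 : d = 0.
    apply: hnorm_eq0; apply/eqP; rewrite eq_le hnorm_ge0 andbT.
    apply: le_trans (hnorm_fst_le (d, T d)) _.
    by rewrite /hnorm dd normr0 /= sqrtr0.
  by move/eqP: d0; rewrite subr_eq0 => /eqP uz; rewrite /p uz.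
(* Both sides equal [inner (p z) (p w)]. *)
have sp z w : inner (p z) w = inner z (p w) :> A.
  rewrite -[RHS]inner_star -[LHS](orth w (u z)) -[inner (p w) z](orth z (u w)).
  by rewrite inner_star.
have pl : linear p.
  move=> k z w; rewrite [RHS](_ : _ = (k *: u z + u w, T (k *: u z + u w))).
    apply: uniq => x.
    have -> : ((k *: u z + u w, T (k *: u z + u w)) : E * F) = k *: p z + p w.
      by rewrite linearP.
    by rewrite !innerDr !innerZr !orth.
  by rewrite linearP.
have pa (a : A) z : p (act a z) = act a (p z).
  rewrite [RHS](_ : _ = (act a (u z), T (act a (u z)))).
    apply: uniq => x.
    have -> : ((act a (u z), T (act a (u z))) : E * F) = act a (p z).
      by rewrite adj_act.
    by rewrite !inner_actr orth.
  by rewrite adj_act.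
have pe : exists p' : E * F -> E * F, forall z w, inner (p z) w = inner z (p' w) :> A.
  by exists p.
exists (Adjointable pl pa pe); split=> //=.
- by move=> z; apply: uniq. 
- apply/seteqP; split=> [_ [z _ <-]|_ [x _ <-]]; first by exists (u z).
  by exists (x, T x) => //; apply: uniq.
Qed.

(** Existence ensures that [xget] returns a genuine projection and not its dummy value. *)
Lemma projection_onto_graph T :
  orthogonal_projection (graph T) (projection_onto (graph T)).
Proof. by have [P hP] := graph_projection_ex T; apply: (xgetPex _ (ex_intro _ P hP)). Qed.

Section TwoProjections.
Variables (T S : adjointable E F) (P Q : adjointable (E * F)%type (E * F)%type).
Hypotheses (hP : orthogonal_projection (graph T) P)
  (hQ : orthogonal_projection (graph S) Q).

Lemma proj_graph_ex z : exists x, P z = (x, T x).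
Proof.
have [_ _ rP] := hP; have : range P (P z) by exists z.
by rewrite rP => -[x _ <-]; exists x.
Qed.

Lemma proj_graph_id x : P (x, T x) = (x, T x).
Proof.
have [PP _ rP] := hP; have : graph T (x, T x) by exists x.
by rewrite -rP => -[z _ <-].
Qed.

End TwoProjections.

Lemma proj_compl_comp_le T S P Q c :
  orthogonal_projection (graph T) P -> orthogonal_projection (graph S) Q ->
  0 <= c -> bounded_by (fun x => T x - S x) c ->
  bounded_by (fun z => P z - Q (P z)) c.
Proof.
move=> hP hQ c0 TS z; have [PP sP _] := hP; have [QQ sQ _] := hQ.
have [u uE] := proj_graph_ex hP z.
pose d : E * F := (0, T u - S u).
(* The summand [(u, S u)] lies in the graph of [S] and is killed by [1 - Q]. *)
have dE : P z = d + (u, S u) by rewrite uE; congr (_, _); rewrite /= ?add0r ?subrK.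
have -> : P z - Q (P z) = d - Q d.
  by rewrite dE linearD /= (proj_graph_id hQ) opprD addrACA subrr addr0.
apply: le_trans (selfadj_idem_compl_le hEF QQ sQ d) _.
apply: le_trans (hnorm_pair_le _ _) _; rewrite hnorm0 add0r.
apply: le_trans (TS u) _; rewrite ler_wpM2l//.
apply: le_trans (selfadj_idem_le hEF PP sP z).
by rewrite uE; exact: (hnorm_fst_le (u, T u)).
Qed.

(* [P - Q = (1 - Q) P - ((1 - P) Q)^*]. *)
Lemma proj_sub_le T S P Q c :
  orthogonal_projection (graph T) P -> orthogonal_projection (graph S) Q ->
  0 <= c -> bounded_by (fun x => T x - S x) c ->
  bounded_by (fun z => P z - Q z) (2 * c).
Proof.
move=> hP hQ c0 TS z; have [PP sP _] := hP; have [QQ sQ _] := hQ.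
have ST : bounded_by (fun x => S x - T x) c.
  by move=> x; rewrite -hnormN opprB; apply: TS.
have h1 := proj_compl_comp_le hP hQ c0 TS z.
have h2 : bounded_by (fun z => Q z - Q (P z)) c.
  apply: (bounded_by_adjoint hEF c0 _ (proj_compl_comp_le hQ hP c0 ST)) => x y.
  by rewrite innerBl innerBr !sQ sP.
have -> : P z - Q z = (P z - Q (P z)) - (Q z - Q (P z)).
  by rewrite opprB subrKA.
apply: le_trans (hnormB hEF _ _) _.
by rewrite mulr_natl mulr2n mulrDl lerD.
Qed.

(** The constant involves a bound for [T] alone, so [S] may vary freely near [T]. *)
Lemma sub_le_proj_sub T S P Q c g :
  orthogonal_projection (graph T) P -> orthogonal_projection (graph S) Q ->
  0 <= c -> bounded_by T c -> 0 <= g -> 2 * ((1 + c) * g) <= 1 ->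
  bounded_by (fun z => P z - Q z) g ->
  bounded_by (fun x => T x - S x) (2 * (1 + c) ^+ 2 * g).
Proof.
move=> hP hQ c0 Tc g0 cg PQ x.
pose z : E * F := (x, S x); have [u uE] := proj_graph_ex hP z.
have zg : hnorm ((u - x, T u - S x) : E * F) <= g * hnorm z.
  by have := PQ z; rewrite uE (proj_graph_id hQ).
have h1 := le_trans (hnorm_fst_le (u - x, T u - S x)) zg.
have h2 := le_trans (hnorm_snd_le (u - x, T u - S x)) zg.
have h3 : hnorm (T (u - x)) <= c * (g * hnorm z).
  by apply: le_trans (Tc _) _; rewrite ler_wpM2l.
have h4 : hnorm (T x - S x) <= (1 + c) * (g * hnorm z).
  have -> : T x - S x = (T u - S x) - T (u - x).
    by rewrite linearB/= opprB [RHS]addrC subrKA.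
  by apply: le_trans (hnormB hF _ _) _; move: h2 => /=; lra.
have h5 : hnorm z <= (1 + c) * hnorm x + hnorm (T x - S x).
  apply: le_trans (hnorm_pair_le _ _) _.
  have : hnorm (S x) <= hnorm (T x) + hnorm (T x - S x).
    by rewrite -{1}[S x](subKr (T x)); apply: hnormB.
  by have := Tc x; lra.
set n := hnorm (T x - S x) in h4 h5 *.
have n0 : 0 <= n by exact: hnorm_ge0.
have : (1 + c) * g * hnorm z <= (1 + c) * g * ((1 + c) * hnorm x + n).
  by rewrite ler_wpM2l// mulr_ge0// addr_ge0.
(* At most half of [n] comes back on the right; absorbing it produces the factor 2 in the
   conclusion. *)
have : 2 * ((1 + c) * g) * n <= n by rewrite ler_piMl.
lra.
Qed.

End OrthogonalProjection.

(** * Comparison of the two topologies *)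

(** The radius may depend on the centre, as it does below through the bound for [T]. *)
Lemma metric_topology_eq (R : realType) (X : Type) (d1 d2 : X -> X -> R) :
  (forall x e, 0 < e -> exists2 r, 0 < r & forall y, d1 x y < r -> d2 x y < e) ->
  (forall x e, 0 < e -> exists2 r, 0 < r & forall y, d2 x y < r -> d1 x y < e) ->
  metric_topology d1 = metric_topology d2.
Proof.
move=> H12 H21; apply/seteqP; split=> U HU x /HU[e e0 eU].
  by have [r r0 rU] := H21 x _ e0; exists r => // y /= yr; apply: eU; apply: rU.
by have [r r0 rU] := H12 x _ e0; exists r => // y /= yr; apply: eU; apply: rU.
Qed.

Theorem proposition3p2 (R : realType) (A : cstarAlgType R)
    (E F : hilbertModType A) :
  metric_topology (@norm_dist R A E F) = metric_topology (@gap_dist R A E F).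
Proof.
have subZ (G H : hermitianModType A) (T S : adjointable G H) (k : R[i]) x :
    (T \- S) (k *: x) = k *: (T \- S) x.
  by rewrite /= (linearZZ T) (linearZZ S) scalerBr.
have norm_bounded (T S : adjointable E F) :
    bounded_by (fun x => T x - S x) (norm_dist T S).
  have [a a0 Ta] := adjointable_bounded T; have [b b0 Sb] := adjointable_bounded S.
  apply: (@bounded_by_opnorm _ _ _ _ (T \- S) (a + b)); first exact: subZ.
    exact: addr_ge0.
  move=> x; apply: le_trans (hnormB (@psd_hilbert _ _ _) _ _) _.
  by rewrite mulrDl lerD.
have gap_le (T S : adjointable E F) : gap_dist T S <= 2 * norm_dist T S.
  apply: opnorm_le; first by rewrite mulr_ge0// opnorm_ge0.
  apply: proj_sub_le (norm_bounded T S); last exact: opnorm_ge0;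
    exact: projection_onto_graph.
have gap_bounded (T S : adjointable E F) :
    bounded_by (fun z => projection_onto (graph T) z - projection_onto (graph S) z)
      (gap_dist T S).
  apply: (@bounded_by_opnorm _ _ _ _ (_ \- _) (2 * norm_dist T S)); first exact: subZ.
    by rewrite mulr_ge0// opnorm_ge0.
  apply: proj_sub_le (norm_bounded T S); last exact: opnorm_ge0;
    exact: projection_onto_graph.
apply: metric_topology_eq => T e e0.
  exists (e / 2); first by rewrite divr_gt0.
  by move=> S TS; apply: le_lt_trans (gap_le T S) _; rewrite mulrC -ltr_pdivlMr.
have [c c0 Tc] := adjointable_bounded T.
have c1 : 0 < 1 + c by rewrite ltr_pwDl.
have c2 : 0 < 2 * (1 + c) ^+ 2 by rewrite mulr_gt0// exprn_gt0.
(* The first radius allows the absorption in [sub_le_proj_sub]; the second brings its bound below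
   [e]. *)
exists (Num.min (2 * (1 + c))^-1 (e / (2 * (1 + c) ^+ 2))).
  by rewrite lt_min invr_gt0 divr_gt0// mulr_gt0.
move=> S; rewrite lt_min => /andP[g1 g2].
apply: le_lt_trans (_ : 2 * (1 + c) ^+ 2 * gap_dist T S < e); last first.
  by rewrite mulrC -ltr_pdivlMr.
have g0 : 0 <= gap_dist T S by exact: opnorm_ge0.
apply: opnorm_le; first by rewrite mulr_ge0// ltW.
apply: sub_le_proj_sub (gap_bounded T S) => //; try exact: projection_onto_graph.
by rewrite mulrA -ler_pdivlMl ?mulr_gt0// mulr1 ltW.
Qed.
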